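(* Let $\mu\in\mathbb{R}^3$ with $\mu\ne0$, and let $X\sim N(\mu,\sigma^2I_3)$ (so that $\frac{X}{\|\mu\|}\sim N\bigl(\frac{\mu}{\|\mu\|},\frac{\sigma^2}{\|\mu\|^2}I_3\bigr)$). Then the intrinsic covariance of $\mathrm{pr}(X)=X/\|X\|$ on $\mathbb{S}^2$ satisfies $\operatorname{Cov}(\mathrm{pr}(X))=vI_2$ for some $0\le v<\frac{\pi^2-4}{4}$, and the relation $$f\left(\frac{\sigma^2}{\|\mu\|^2}\right):=\frac{\operatorname{trace}(\operatorname{Cov}(\mathrm{pr}(X)))}{2}=v$$ is a bijection, i.e. $f$ is a bijection from $[0,\infty)$ (the values of $\lambda=\sigma^2/\|\mu\|^2$) onto $[0,\frac{\pi^2-4}{4})$ (the values of $v$).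
   Context: $\mathbb{S}^2\subset\mathbb{R}^3$ is the unit sphere with the induced Riemannian metric, geodesic distance $\operatorname{dist}$ and volume form $\mathrm{dVol}$. For $q\in\mathbb{S}^2$, $\log_q$ is the (a.e. defined) inverse of the Riemannian exponential map at $q$. For an absolutely continuous $\mathbb{S}^2$-valued random variable $Y$ with density $p_Y$ with respect to $\mathrm{dVol}$, the intrinsic mean $m=\mathbb{E}[Y]$ is the minimizer over $q\in\mathbb{S}^2$ of $\int_{\mathbb{S}^2}\operatorname{dist}(q,y)^2p_Y(y)\,\mathrm{dVol}(y)$, and the intrinsic covariance is the linear map $\operatorname{Cov}(Y):T_m\mathbb{S}^2\to T_m\mathbb{S}^2$, $$\operatorname{Cov}(Y)=\int_{\mathbb{S}^2}\log_m(y)\log_m(y)^Tp_Y(y)\,\mathrm{dVol}(y).$$ For $X\sim N(\mu,\sigma^2I_3)$ with $\mu\neq0$, $\sigma>0$, the intrinsic mean of $\mathrm{pr}(X)$ is $\mu/\|\mu\|$. $I_2$ denotes the identity of the two-dimensional tangent space. The distribution of $\mathrm{pr}(X)$ depends on $(\mu,\sigma)$ only through $\mu/\|\mu\|$ and $\lambda=\sigma^2/\|\mu\|^2$. The degenerate case $\sigma=0$ corresponds to a point mass, with covariance $0$, so $f(0)=0$. Explicitly, for $\lambda>0$ and $x=1/\sqrt\lambda$, $$f(\lambda)=\frac{\pi}{(2\pi)^{3/2}}e^{-x^2/2}\int_0^\pi\phi^2\left(x\cos\phi+(x^2\cos^2\phi+1)\frac{\Phi(x\cos\phi)}{\varphi(x\cos\phi)}\right)\sin\phi\,d\phi,$$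 where $\varphi(t)=\exp(-t^2/2)$ and $\Phi(a)=\int_{-\infty}^a\varphi(t)\,dt$ (no normalizing constant). *)

(* Defs.v *)
From mathcomp Require Import all_boot all_order all_algebra.
From mathcomp Require Import all_classical all_reals all_analysis.

Set Implicit Arguments.
Unset Strict Implicit.
Unset Printing Implicit Defensive.

Import Order.TTheory GRing.Theory Num.Theory.
Import numFieldNormedType.Exports.

Local Open Scope classical_set_scope.
Local Open Scope ring_scope.

(* The library norm on 'rV[R]_3 is the sup norm, hence this Euclidean one. *)
Definition dot (R : realType) (u v : 'rV[R]_3) : R := (u *m v^T) 0 0.
Definition enorm (R : realType) (u : 'rV[R]_3) : R := Num.sqrt (dot u u).

Definition sphere (R : realType) : set 'rV[R]_3 := [set q | enorm q = 1].
Definition pr (R : realType) (x : 'rV[R]_3) : 'rV[R]_3 := (enorm x)^-1 *: x.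

(* Great-circle distance; meaningful on the unit sphere only. *)
Definition sdist (R : realType) (p q : 'rV[R]_3) : R := acos (dot p q).

(* The vectors orthogonal to q, as a subspace of R^3. *)
Definition tangent_space (R : realType) (q : 'rV[R]_3) : {vspace 'rV[R]_3} :=
  lker (linfun (mulmxr q^T : 'rV[R]_3 -> 'M[R]_(1, 1))).

Definition exp_map (R : realType) (q v : 'rV[R]_3) : 'rV[R]_3 :=
  cos (enorm v) *: q + (sin (enorm v) / enorm v) *: v.

(* Inverse of exp_map q on the tangent disc of radius pi (the injectivity
   radius); the value is 0 outside its image, i.e. at the antipode of q. *)
Definition log_map (R : realType) (q y : 'rV[R]_3) : 'rV[R]_3 :=
  xget 0 [set v | [/\ v \in tangent_space q, enorm v < pi & exp_map q v = y]].

Section Intrinsic.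
Context d (T : measurableType d) (R : realType) (P : probability T R).
Variable Y : T -> 'rV[R]_3.

(* Integrals against the law of Y are taken on the sample space: when Y has a
   density p, 'E_P[g \o Y] is the integral of g * p on the sphere, and point
   masses need no separate treatment. *)
Definition frechet (q : 'rV[R]_3) : \bar R :=
  'E_P[fun t => sdist q (Y t) ^+ 2].

Definition is_intrinsic_mean (m : 'rV[R]_3) : Prop :=
  sphere m /\ forall q, sphere q -> (frechet m <= frechet q)%E.

Definition intrinsic_mean : 'rV[R]_3 := xget 0 [set m | is_intrinsic_mean m].

(* E[log_m(Y)^T log_m(Y)] in ambient coordinates (vectors are rows). *)
Definition log_moment (m : 'rV[R]_3) : 'M[R]_3 :=
  \matrix_(i, j) fine 'E_P[fun t => log_map m (Y t) 0 i * log_map m (Y t) 0 j].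

(* log_map m is tangent at m, so the rows of log_moment m are too, and vsproj
   only retypes w *m log_moment m as a tangent vector. *)
Definition intrinsic_cov : 'End(subvs_of (tangent_space intrinsic_mean)) :=
  linfun (fun w => vsproj (tangent_space intrinsic_mean)
                     (vsval w *m log_moment intrinsic_mean)).

End Intrinsic.

Definition lfun_trace (F : fieldType) (V : vectType F) (g : 'End(V)) : F :=
  \tr (passmx.mxof (vbasis fullv) (vbasis fullv) g).

(* normal_prob m 0 is not a point mass in the library. *)
Definition normal_law (R : realType) (m s : R) :
    probability (measurableTypeR R) R :=
  if s == 0 then (@dirac _ (measurableTypeR R) m R : probability (measurableTypeR R) R)
  else (normal_prob m s : probability (measurableTypeR R) R).

(* X ~ N(mu, sigma^2 I_3): the joint law of the coordinates of X is the product
   of the N(mu_i, sigma^2). *)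
Definition isotropic_normal d (T : measurableType d) (R : realType)
    (P : probability T R) (X : T -> 'rV[R]_3) (mu : 'rV[R]_3) (sigma : R) :
    Prop :=
  let N i := normal_law (mu 0 i) sigma in
  let coords t := (X t 0 (inord 0), X t 0 (inord 1), X t 0 (inord 2)) in
  measurable_fun setT coords /\
  forall A, measurable A ->
    P (coords @^-1` A) = ((N (inord 0) \x N (inord 1)) \x N (inord 2))%E A.

Lemma isotropic_normal_exists (R : realType) (mu : 'rV[R]_3) (sigma : R) :
  exists (d : measure_display) (T : measurableType d) (P : probability T R)
    (X : T -> 'rV[R]_3), isotropic_normal P X mu sigma.
Proof.
pose N i := normal_law (mu 0 i) sigma.
exists _, _, ((N (inord 0) \x N (inord 1)) \x N (inord 2))%E.
pose X (t : R * R * R) : 'rV[R]_3 := \row_i nth 0 [:: t.1.1; t.1.2; t.2] i.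
have XE : (fun t => (X t 0 (inord 0), X t 0 (inord 1), X t 0 (inord 2))) = id.
  by apply/funext => -[[a b] c]; rewrite /X !mxE !inordK.
by exists X; split => [|A mA]; rewrite XE//; exact: measurable_id.
Qed.

(* Main.v *)
Require Import Defs.
From HB Require Import structures.
From mathcomp Require Import all_boot all_order all_algebra.
From mathcomp Require Import all_classical all_reals all_analysis.
From mathcomp Require Import measurable_realfun ring lra.

Set Implicit Arguments.
Unset Strict Implicit.
Unset Printing Implicit Defensive.

Import Order.TTheory GRing.Theory Num.Theory.
Import numFieldNormedType.Exports.

Local Open Scope classical_set_scope.
Local Open Scope ring_scope.

(** Let m = mu / |mu|, s = sigma / |mu|, and let G be a standard normal vector
    of R^3.  The direction of X has the law of the direction of m + s G.  When
    the first axis of R^3 is m, its angle with m is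
    pi / 2 - atan ((G_1 + 1 / s) / rho), where rho is the norm of (G_2, G_3):
    as s grows from 0 to infinity this angle increases, for almost every G,
    from 0 to the angle between m and G.  The number v is half of its mean
    square, and all the assertions about f follow from this formula.

    Symmetry.  Lebesgue measure on R^3 is preserved by orthogonal maps; this is
    deduced from its translation invariance alone, by computing one double
    integral in two ways ([integral_leb3_linear]).  Hence N(mu, sigma^2 I) is
    the image of the law of G by g |-> mu + sigma g A for every orthogonal A
    ([integral_normal3_std]).

    The mean.  For a unit vector q other than m, the reflection exchanging m
    and q multiplies the density of X by a weight w, the exponential of
    |mu| <x, q - m> / sigma^2.  If a and b are the squared distances of the
    direction of X to m and to q, it follows that
    2 (E b - E a) = E ((b - a) (1 - w)).  Both factors are positive on one side
    of the plane of symmetry and negative on the other, so m is the only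
    intrinsic mean ([expect_sqdist_lt], [intrinsic_mean_isotropic]).

    The covariance.  The logarithm at m of the direction of m + s G is the
    angle times the unit vector along (G_2, G_3).  Exchanging the last two
    axes, or reversing one of them, preserves the law of G, so the second
    moments of the logarithm form a multiple v of the projection onto the
    tangent plane ([log_moment_isotropic]), and the trace is 2 v.

    The bijection.  The mean square angle [msq_angle], a function of x = 1 / s,
    is strictly decreasing because its integrand is; by dominated convergence
    it is continuous and tends to 0 at infinity.  Its value at 0, the mean
    square of the angle between m and a uniform direction, is (pi^2 - 4) / 2
    ([msq_angle0]), because G_1 / rho has density cos (atan u)^3 / 2. *)

(** * Geometry of the sphere *)

Section geometry.
Variable R : realType.
Implicit Types (q m u v x y z w : 'rV[R]_3) (A : 'M[R]_3).

Lemma sum_ord3 (V : nmodType) (F : 'I_3 -> V) :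
  \sum_i F i = F (inord 0) + F (inord 1) + F (inord 2).
Proof.
rewrite !big_ord_recl big_ord0 addr0 addrA.
by congr (F _ + F _ + F _); apply/val_inj; rewrite /= ?inordK.
Qed.

Lemma dotE (u v : 'rV[R]_3) : dot u v = \sum_i u 0 i * v 0 i.
Proof. by rewrite /dot mxE; apply: eq_bigr => i _; rewrite mxE. Qed.

Lemma dotC x y : dot x y = dot y x.
Proof. by rewrite !dotE; apply: eq_bigr => i _; rewrite mulrC. Qed.

Lemma dotDl x y z : dot (x + y) z = dot x z + dot y z.
Proof. by rewrite /dot mulmxDl mxE. Qed.

Lemma dotDr x y z : dot z (x + y) = dot z x + dot z y.
Proof. by rewrite dotC dotDl !(dotC z). Qed.

Lemma dotZl (a : R) x y : dot (a *: x) y = a * dot x y.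
Proof. by rewrite /dot -scalemxAl mxE. Qed.

Lemma dotZr (a : R) x y : dot x (a *: y) = a * dot x y.
Proof. by rewrite dotC dotZl dotC. Qed.

Lemma dotZ (a b : R) x y : dot (a *: x) (b *: y) = a * b * dot x y.
Proof. by rewrite /dot linearZ/= -scalemxAl -scalemxAr scalerA mxE. Qed.

Lemma dotNl x y : dot (- x) y = - dot x y.
Proof. by rewrite -scaleN1r dotZl mulN1r. Qed.

Lemma dotNr x y : dot x (- y) = - dot x y.
Proof. by rewrite dotC dotNl dotC. Qed.

Lemma dotNN x : dot (- x) (- x) = dot x x.
Proof. by rewrite -scaleN1r dotZ mulrNN !mul1r. Qed.

Lemma dot0l x : dot 0 x = 0.
Proof. by rewrite /dot mul0mx mxE. Qed.

Lemma dot0r x : dot x 0 = 0.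
Proof. by rewrite dotC dot0l. Qed.

Lemma dot_delta x i : dot x (delta_mx 0 i) = x 0 i.
Proof.
rewrite dotE (bigD1 i)//= mxE !eqxx mulr1 big1 ?addr0// => j ji.
by rewrite [X in _ * X]mxE (negbTE ji) andbF mulr0.
Qed.

Lemma dot_ge0 x : 0 <= dot x x.
Proof. by rewrite dotE sumr_ge0// => i _; rewrite -expr2 sqr_ge0. Qed.

(** By 2 |ab| <= a^2 + b^2, where both squares are at most [dot x x]. *)
Lemma norm_coordM_le (c : R) x i j :
  dot x x <= c -> `|x 0 i * x 0 j| <= c.
Proof.
have sq k : x 0 k ^+ 2 <= dot x x.
  rewrite dotE (bigD1 k)//= -expr2 lerDl.
  by apply: sumr_ge0 => l _; rewrite -expr2 sqr_ge0.
have := sq i; have := sq j; rewrite ler_norml.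
set a := x 0 i; set b := x 0 j => bp ap xc.
have := sqr_ge0 (a + b); have := sqr_ge0 (a - b).
by rewrite sqrrB sqrrD => h1 h2; apply/andP; split; lra.
Qed.

Lemma dot_eq0 x : (dot x x == 0) = (x == 0).
Proof.
apply/eqP/eqP => [|->]; last exact: dot0l.
rewrite dotE => /psumr_eq0P x0; apply/rowP => i; rewrite mxE; apply/eqP.
by rewrite -(sqrf_eq0 (x 0 i)) expr2; apply/eqP/x0 => // j _; rewrite -expr2 sqr_ge0.
Qed.

Lemma sqr_enorm x : enorm x ^+ 2 = dot x x.
Proof. by rewrite sqr_sqrtr// dot_ge0. Qed.

Lemma enorm_ge0 x : 0 <= enorm x. Proof. exact: sqrtr_ge0. Qed.

Lemma enorm_eq0 x : (enorm x == 0) = (x == 0).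
Proof. by rewrite -dot_eq0 -sqr_enorm sqrf_eq0. Qed.

Lemma enorm_gt0 x : (0 < enorm x) = (x != 0).
Proof. by rewrite lt_neqAle enorm_ge0 andbT eq_sym enorm_eq0. Qed.

Lemma enorm0 : enorm (0 : 'rV[R]_3) = 0.
Proof. by apply/eqP; rewrite enorm_eq0. Qed.

Lemma sphereE q : sphere q <-> dot q q = 1.
Proof.
rewrite /sphere/=; split => [q1|qq]; first by rewrite -sqr_enorm q1 expr1n.
by rewrite /enorm qq sqrtr1.
Qed.

Lemma enormZ (a : R) x : enorm (a *: x) = `|a| * enorm x.
Proof. by rewrite /enorm dotZ -expr2 sqrtrM ?sqr_ge0// sqrtr_sqr. Qed.

Lemma pr_sphere x : x != 0 -> sphere (pr x).
Proof.
rewrite -enorm_gt0 => x0; rewrite /sphere/= /pr enormZ ger0_norm ?invr_ge0 ?ltW//.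
by rewrite mulVf// gt_eqF.
Qed.

Lemma pr0 : pr (0 : 'rV[R]_3) = 0. Proof. by rewrite /pr scaler0. Qed.

Lemma enorm_scale_pr x : x = enorm x *: pr x.
Proof.
have [->|x0] := eqVneq x 0; first by rewrite pr0 scaler0.
by rewrite /pr scalerA divff ?scale1r// enorm_eq0.
Qed.

Lemma sphere_neq0 q : sphere q -> q != 0.
Proof. by rewrite -enorm_eq0 => ->; rewrite oner_eq0. Qed.

(** Bessel's inequality for one unit vector, with its defect. *)
Lemma dot_residual q y : sphere q ->
  dot (y - dot q y *: q) (y - dot q y *: q) = dot y y - dot q y ^+ 2.
Proof.
move=> /sphereE qq.
rewrite dotDl !dotDr !dotNl !dotNr !dotZl !dotZr qq (dotC y q); ring.
Qed.

Lemma sqr_dot_le q y : sphere q -> dot q y ^+ 2 <= dot y y.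
Proof. by move=> sq; rewrite -subr_ge0 -dot_residual// dot_ge0. Qed.

Lemma dot_pr_le1 q x : sphere q -> -1 <= dot q (pr x) <= 1.
Proof.
move=> sq; rewrite -ler_norml -(@ler_pXn2r _ 2) ?nnegrE// expr1n real_normK ?num_real//.
have [->|x0] := eqVneq x 0; first by rewrite pr0 dot0r expr0n ler01.
by rewrite (le_trans (sqr_dot_le _ sq))//; have /sphereE-> := pr_sphere x0.
Qed.

Lemma dot_sphere_eq1 q y : sphere q -> sphere y -> dot q y = 1 -> y = q.
Proof.
move=> sq /sphereE yy qy; have := dot_residual y sq.
rewrite qy yy scale1r expr1n subrr => /eqP; rewrite dot_eq0 subr_eq0.
by move/eqP.
Qed.

Lemma dot_sphere_le1 q y : sphere q -> sphere y -> -1 <= dot q y <= 1.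
Proof.
move=> sq sy; rewrite -ler_norml -(@ler_pXn2r _ 2) ?nnegrE// expr1n.
by rewrite real_normK ?num_real// (le_trans (sqr_dot_le _ sq))//; move/sphereE: sy => ->.
Qed.

Definition orthomx (A : 'M[R]_3) := A *m A^T = 1%:M.

Lemma orthomx_unit A : orthomx A -> A \in unitmx.
Proof. by move=> /mulmx1_unit[]. Qed.

Lemma dot_orthomx A x y : orthomx A -> dot (x *m A) (y *m A) = dot x y.
Proof. by move=> oA; rewrite /dot trmx_mul mulmxA -(mulmxA x) oA mulmx1. Qed.

Lemma mul_trmx_row x w : x *m w^T *m w = dot x w *: w.
Proof. by rewrite [X in X *m w]mx11_scalar mul_scalar_mx. Qed.

(** The reflection in the plane orthogonal to u - v, acting on rows.  When
    u = v the coefficient [2 / 0] is 0 and the reflection is the identity, so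
    that [householder_swap] holds for all vectors of equal norm. *)
Definition householder u v : 'M[R]_3 :=
  let w := u - v in 1%:M - (2 / dot w w) *: (w^T *m w).

Lemma mul_householder u v x :
  x *m householder u v = x - (2 / dot (u - v) (u - v) * dot x (u - v)) *: (u - v).
Proof. by rewrite mulmxBr mulmx1 -scalemxAr mulmxA mul_trmx_row scalerA. Qed.

Lemma householder_sym u v : (householder u v)^T = householder u v.
Proof. by rewrite /householder linearB/= linearZ/= trmx_mul trmxK trmx1. Qed.

Lemma householderK u v x : x *m householder u v *m householder u v = x.
Proof.
rewrite !mul_householder; set w := u - v.
have [w0|w0] := eqVneq (dot w w) 0.
  by rewrite w0 invr0 !(mulr0, mul0r) scale0r !subr0.
rewrite dotDl dotNl dotZl -addrA -opprD -scalerDl -[RHS]subr0.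
by congr (_ - _); rewrite -[RHS](scale0r w); congr (_ *: _); field.
Qed.

Lemma householder_orthomx u v : orthomx (householder u v).
Proof.
rewrite /orthomx householder_sym; apply/row_matrixP => i.
by rewrite !rowE mulmxA householderK mulmx1.
Qed.

Lemma householder_swap u v : dot u u = dot v v -> u *m householder u v = v.
Proof.
move=> uv; rewrite mul_householder; have [->|neq] := eqVneq u v.
  by rewrite subrr scaler0 subr0.
have w0 : dot (u - v) (u - v) != 0 by rewrite dot_eq0 subr_eq0.
rewrite [X in X *: _](_ : _ = 1) ?scale1r ?subKr//.
apply: (mulIf w0); rewrite mul1r mulrAC divfK//.
rewrite dotDl !dotDr !dotNl !dotNr (dotC v u) -uv; ring.
Qed.

Lemma householder_swapr u v : dot u u = dot v v -> v *m householder u v = u.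
Proof. by move=> /householder_swap {1}<-; rewrite householderK. Qed.

Definition e1 : 'rV[R]_3 := delta_mx 0 (inord 0).

Lemma dot_e1 x : dot x e1 = x 0 (inord 0).
Proof. exact: dot_delta. Qed.

Lemma sphere_e1 : sphere e1.
Proof. by apply/sphereE; rewrite dot_e1 mxE !eqxx. Qed.

Lemma householder_e1 q : sphere q -> e1 *m householder e1 q = q.
Proof.
move=> /sphereE qq; apply: householder_swap.
by rewrite qq; have /sphereE := sphere_e1.
Qed.

Lemma enorm_orthomx A x : orthomx A -> enorm (x *m A) = enorm x.
Proof. by move=> oA; rewrite /enorm dot_orthomx. Qed.

Lemma pr_orthomx A x : orthomx A -> pr (x *m A) = pr x *m A.
Proof. by move=> oA; rewrite /pr enorm_orthomx// -scalemxAl. Qed.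

Lemma sphere_orthomx A q : orthomx A -> sphere q -> sphere (q *m A).
Proof. by move=> oA; rewrite /sphere/= enorm_orthomx. Qed.

Lemma sdist_orthomx A q y : orthomx A -> sdist (q *m A) (y *m A) = sdist q y.
Proof. by move=> oA; rewrite /sdist dot_orthomx. Qed.

Lemma tangent_spaceE q v : (v \in tangent_space q) = (dot v q == 0).
Proof.
rewrite memv_ker lfunE/= /dot; apply/eqP/eqP => [->|vq]; first by rewrite mxE.
by apply/matrixP => i j; rewrite !ord1 vq mxE.
Qed.

(** The inner product of [exp_map q v] with q is the cosine of the length of v;
    this determines the length, and then v. *)
Lemma exp_map_log q v y : sphere q -> v \in tangent_space q -> enorm v < pi ->
  exp_map q v = y ->
  v = (acos (dot q y) / Num.sqrt (1 - dot q y ^+ 2)) *: (y - dot q y *: q).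
Proof.
move=> sq; rewrite tangent_spaceE => /eqP vq vpi; rewrite /exp_map => yE.
have qq := (sphereE q).1 sq.
have cE : dot q y = cos (enorm v).
  by rewrite -yE dotDr !dotZr qq mulr1 (dotC q v) vq mulr0 addr0.
have vI : enorm v \in `[0, pi] by rewrite in_itv/= enorm_ge0 ltW.
rewrite cE cosK// -sin_acos ?cos_geN1 ?cos_le1// cosK//.
rewrite -yE [X in _ *: (X - _)]addrC addrK scalerA.
have [v0|v0] := eqVneq v 0; first by rewrite [in RHS]v0 scaler0.
have s0 : 0 < sin (enorm v) by apply: sin_gt0_pi; rewrite enorm_gt0 v0.
by rewrite mulrA divfK ?gt_eqF// divff ?scale1r// enorm_eq0.
Qed.

(** The formula needs no exception: the residual [y - dot q y *: q] vanishes at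
    the antipode, where the logarithm is 0 because the exponential map of the
    open disc misses it, and at the origin, which is the value of [pr] at 0. *)
Lemma log_mapE q y : sphere q -> y = 0 \/ sphere y ->
  log_map q y =
  (acos (dot q y) / Num.sqrt (1 - dot q y ^+ 2)) *: (y - dot q y *: q).
Proof.
move=> sq y01; have qq := (sphereE q).1 sq.
have logN : (forall v, exp_map q v = y -> v \in tangent_space q -> ~ enorm v < pi) ->
    log_map q y = 0.
  by move=> N; apply: xgetPN => v [vq vpi /N]; exact.
have dot_exp v : v \in tangent_space q -> dot q (exp_map q v) = cos (enorm v).
  rewrite tangent_spaceE => /eqP vq.
  by rewrite dotDr !dotZr qq mulr1 (dotC q v) vq mulr0 addr0.
case: y01 => [y0|sy].
  rewrite logN; first by rewrite y0 dot0r scale0r subrr scaler0.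
  move=> v; rewrite y0 => vE vq vpi.
  have vI : enorm v \in `[0, pi] by rewrite in_itv/= enorm_ge0 ltW.
  have c0 : cos (enorm v) = 0 by rewrite -dot_exp// vE dot0r.
  have v0 : v != 0.
    rewrite -enorm_eq0; apply/eqP => v0; move: c0; rewrite v0 cos0 => /eqP.
    by rewrite oner_eq0.
  have s0 : 0 < sin (enorm v) by apply: sin_gt0_pi; rewrite enorm_gt0 v0.
  move: vE; rewrite /exp_map c0 scale0r add0r => /eqP.
  by rewrite scaler_eq0 (negbTE v0) orbF mulf_eq0 invr_eq0 enorm_eq0 (negbTE v0) gt_eqF.
have yy := (sphereE y).1 sy.
have /andP[] := dot_sphere_le1 sq sy.
rewrite le_eqVlt => /predU1P[cN1 _|c1 cle1].
  have -> : y = - q.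
    have /sphereE nq : dot (- q) (- q) = 1 by rewrite dotNN.
    by apply: dot_sphere_eq1 => //; rewrite dotNl -cN1 opprK.
  rewrite dotNr qq scaleN1r opprK addNr scaler0 /log_map xgetPN// => v [vq vpi vE].
  have := dot_exp _ vq; rewrite vE dotNr qq -cospi => /eqP; rewrite eq_sym => /eqP.
  have vI : enorm v \in `[0, pi] by rewrite in_itv/= enorm_ge0 ltW.
  move/(cos_inj vI); rewrite in_itv/= pi_ge0 lexx => /(_ isT) vE'.
  by rewrite vE' ltxx in vpi.
apply: xget_unique => [|v [vq vpi]]; last exact: exp_map_log.
set c := dot q y in c1 cle1 *.
have cI : -1 <= c <= 1 by rewrite ltW.
have [c1'|cn1] := eqVneq c 1.
  have -> : y = q by apply: dot_sphere_eq1.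
  rewrite c1' scale1r subrr scaler0; split.
  - by rewrite tangent_spaceE dot0l.
  - by rewrite enorm0 pi_gt0.
  - by rewrite /exp_map enorm0 cos0 scale1r scaler0 addr0.
have clt1 : c < 1 by rewrite lt_neqAle cn1.
have s0 : 0 < 1 - c ^+ 2.
  by rewrite subr_gt0 -real_normK ?num_real// expr_lt1// ltr_norml c1.
have sq0 : 0 < Num.sqrt (1 - c ^+ 2) by rewrite sqrtr_gt0.
have a0 : 0 < acos c by rewrite acos_gt0// ltW.
have nE : enorm ((acos c / Num.sqrt (1 - c ^+ 2)) *: (y - c *: q)) = acos c.
  rewrite enormZ ger0_norm ?divr_ge0 ?ltW//.
  by rewrite /enorm dot_residual// yy divfK// gt_eqF.
split.
- by rewrite tangent_spaceE dotZl dotDl dotNl dotZl qq mulr1 (dotC y) subrr mulr0.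
- by rewrite nE acos_ltpi// c1.
- rewrite /exp_map nE acosK ?in_itv//= sin_acos// scalerA.
  rewrite mulrA divfK ?gt_eqF// divff ?gt_eqF//.
  by rewrite scale1r addrC subrK.
Qed.

Lemma pr_sphere_or0 x : pr x = 0 \/ sphere (pr x).
Proof.
by have [->|/pr_sphere] := eqVneq x 0; [left; exact: pr0|right].
Qed.

(** Orthogonal maps are isometries of the sphere, so they commute with the
    logarithm. *)
Lemma log_map_orthomx A q x : orthomx A -> sphere q ->
  log_map (q *m A) (pr (x *m A)) = log_map q (pr x) *m A.
Proof.
move=> oA sq; rewrite !log_mapE//; last 3 first.
- exact: pr_sphere_or0.
- exact: sphere_orthomx.
- exact: pr_sphere_or0.
by rewrite pr_orthomx// dot_orthomx// -[RHS]scalemxAl mulmxBl -!scalemxAl.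
Qed.

End geometry.

(** * Densities and product measures *)

Section density.
Local Open Scope ereal_scope.
Context d (T : measurableType d) (R : realType).
Variables (mu nu : {measure set T -> \bar R}) (p : T -> R).
Hypotheses (mp : measurable_fun setT p) (p0 : forall x, (0 <= p x)%R).
Hypothesis nuE : forall A, measurable A -> nu A = \int[mu]_(x in A) (p x)%:E.

Import HBNNSimple.

(** True for indicators by hypothesis, hence for simple functions, hence for all
    nonnegative functions by monotone convergence. *)
Lemma ge0_integral_density (f : T -> \bar R) : measurable_fun setT f ->
  (forall x, 0 <= f x) -> \int[nu]_x f x = \int[mu]_x (f x * (p x)%:E).
Proof.
move=> mf f0; pose f_ := nnsfun_approx measurableT mf.
have mp' : measurable_fun setT (fun x => (p x)%:E) by exact/measurable_EFinP.
have cf x : EFin \o f_^~ x @ \oo --> f x by apply: cvg_nnsfun_approx.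
transitivity (limn (fun n => \int[nu]_x (f_ n x)%:E)).
  rewrite -monotone_convergence//.
  - by apply: eq_integral => y _; apply/esym/cvg_lim => //; exact: cf.
  - by move=> n; exact/measurable_EFinP.
  - by move=> n y _; rewrite lee_fin.
  - by move=> y _ m n mn; rewrite lee_fin; exact/lefP/nd_nnsfun_approx.
transitivity (limn (fun n => \int[mu]_x ((f_ n x)%:E * (p x)%:E))); last first.
  rewrite -monotone_convergence//.
  - apply: eq_integral => y _; apply/cvg_lim => //.
    by apply: cvgeZr => //; exact: cf.
  - by move=> n; apply: emeasurable_funM => //; exact/measurable_EFinP.
  - by move=> n y _; rewrite mule_ge0 ?lee_fin.
  - move=> y _ m n mn; rewrite lee_wpmul2r ?lee_fin//.
    exact/lefP/nd_nnsfun_approx.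
congr (limn _); apply/funext => n.
under eq_integral do rewrite fimfunE -fsumEFin//.
rewrite ge0_integral_fsum//; last 2 first.
- by move=> y; exact/measurable_EFinP/measurable_funM.
- by move=> y x _; rewrite nnfun_muleindic_ge0.
transitivity (\sum_(k \in range (f_ n))
    \int[mu]_x ((k * \1_(f_ n @^-1` [set k]) x)%:E * (p x)%:E)); last first.
  rewrite -ge0_integral_fsum//.
  - apply: eq_integral => x _; rewrite -ge0_mule_fsuml.
      by rewrite fsumEFin// -fimfunE.
    by move=> r; rewrite nnfun_muleindic_ge0.
  - move=> r; apply: emeasurable_funM => //.
    exact/measurable_EFinP/measurable_funM.
  - by move=> r x _; rewrite mule_ge0 ?nnfun_muleindic_ge0 ?lee_fin.
apply: eq_fsbigr => r /set_mem [x _ xr]; rewrite integralZl_indic_nnsfun//.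
rewrite integral_indic// setIT nuE//.
rewrite [in LHS]integral_mkcond -ge0_integralZl//.
- apply: eq_integral => y _; rewrite EFinM -muleA; congr (_ * _).
  rewrite patchE indicE; case: ifPn => _; first by rewrite mul1e.
  by rewrite mul0e.
- by apply/measurable_restrict => //; exact/measurable_funTS.
- by move=> y _; rewrite patchE; case: ifPn; rewrite ?lee_fin.
- by rewrite lee_fin -xr.
Qed.

End density.

(** The product measure together with its sigma-finiteness, which makes it
    available as a factor of a further product. *)
Section sigma_finite_product.
Local Open Scope ereal_scope.
Context d1 d2 (T1 : measurableType d1) (T2 : measurableType d2) (R : realType).
Variables (m1 : {sigma_finite_measure set T1 -> \bar R}).
Variables (m2 : {sigma_finite_measure set T2 -> \bar R}).

Definition sfprod : set (T1 * T2) -> \bar R := m1 \x m2.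

HB.instance Definition _ := Measure.copy sfprod (m1 \x m2).

Let sfprod_sigma_finite : sigma_finite setT sfprod.
Proof.
have /sigma_finiteP[F [FT ndF Ffin]] := sigma_finiteT m1.
have /sigma_finiteP[G [GT ndG Gfin]] := sigma_finiteT m2.
exists (fun n => F n `*` G n) => [|n].
  apply/seteqP; split=> // -[x y] _.
  have [i _ Fx] : (\bigcup_n F n) x by rewrite -FT.
  have [j _ Gy] : (\bigcup_n G n) y by rewrite -GT.
  exists (i + j)%N => //; split=> /=.
    by move/subsetPset : (ndF _ _ (leq_addr j i)); exact.
  by move/subsetPset : (ndG _ _ (leq_addl i j)); exact.
have [[mF Foo] [mG Goo]] := (Ffin n, Gfin n).
split; first exact: measurableX.
rewrite [X in X < _](product_measure1E _ _ mF mG).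
by apply: lte_mul_pinfty; rewrite ?ge0_fin_numE.
Qed.

HB.instance Definition _ :=
  Measure_isSigmaFinite.Build _ _ _ sfprod sfprod_sigma_finite.

End sigma_finite_product.

Section product_density.
Local Open Scope ereal_scope.
Context d1 d2 (T1 : measurableType d1) (T2 : measurableType d2) (R : realType).
Variables (m1 n1 : {sigma_finite_measure set T1 -> \bar R}).
Variables (m2 n2 : {sigma_finite_measure set T2 -> \bar R}).
Variables (p1 : T1 -> R) (p2 : T2 -> R).
Hypotheses (mp1 : measurable_fun setT p1) (p10 : forall x, (0 <= p1 x)%R).
Hypotheses (mp2 : measurable_fun setT p2) (p20 : forall x, (0 <= p2 x)%R).
Hypothesis n1E : forall A, measurable A -> n1 A = \int[m1]_(x in A) (p1 x)%:E.
Hypothesis n2E : forall A, measurable A -> n2 A = \int[m2]_(x in A) (p2 x)%:E.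

Lemma product_density A : measurable A ->
  (n1 \x n2) A = \int[sfprod m1 m2]_(z in A) (p1 z.1 * p2 z.2)%:E.
Proof.
move=> mA; transitivity (\int[n1]_x (n2 \o xsection A) x) => //.
rewrite (ge0_integral_density mp1 p10 n1E)//; last first.
  exact: measurable_fun_xsection.
have mp12 : measurable_fun setT (fun z : T1 * T2 => (p1 z.1 * p2 z.2)%:E).
  by apply/measurable_EFinP/measurable_funM; exact: measurableT_comp.
rewrite [RHS]integral_mkcond [RHS]fubini_tonelli1//; last 2 first.
- by apply/measurable_restrict => //; exact: measurable_funTS.
- by move=> z; rewrite patchE; case: ifPn; rewrite ?lee_fin ?mulr_ge0.
apply: eq_integral => x _ /=; rewrite n2E; last exact: measurable_xsection.
rewrite [X in X * _]integral_mkcond -ge0_integralZr//.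
- apply: eq_integral => y _; rewrite !patchE mem_xsection.
  by case: ifPn => _; rewrite ?mul0e// muleC EFinM.
- apply/measurable_restrict => //; first exact: measurable_xsection.
  exact/measurable_funTS/measurable_EFinP.
- by move=> y _; rewrite patchE; case: ifPn; rewrite ?lee_fin.
- by rewrite lee_fin.
Qed.

End product_density.




Section translation.
Local Open Scope ereal_scope.

(** The translate of Lebesgue measure gives every interval its length. *)
Lemma lebesgue_measure_translation (R : realType) (a : R) (A : set R) :
  measurable A ->
  (@lebesgue_measure R) ((fun x => x + a)%R @^-1` A) = lebesgue_measure A.
Proof.
move=> mA; pose T : measurableTypeR R -> measurableTypeR R := fun x => (x + a)%R.
have mT : measurable_fun setT T by exact: measurable_funD.
apply/esym.
apply: (@lebesgue_measure_unique _ (pushforward (@lebesgue_measure R) T)) => //.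
move=> _ [[b c]] _ <- /=; rewrite /pushforward.
rewrite (_ : T @^-1` _ = `](b - a)%R, (c - a)%R]%classic).
  by rewrite !lebesgue_measure_itv/= !lte_fin ltrD2r -!EFinB opprD addrACA opprK addNr addr0.
by apply/seteqP; split => x /=; rewrite !in_itv/= /T ltrBlDr lerBrDr.
Qed.

Lemma product_measure_translation d1 d2 (T1 : measurableType d1)
    (T2 : measurableType d2) (R : realType)
    (m1 : {sigma_finite_measure set T1 -> \bar R})
    (m2 : {sigma_finite_measure set T2 -> \bar R})
    (t1 : T1 -> T1) (t2 : T2 -> T2) :
  measurable_fun setT t1 -> measurable_fun setT t2 ->
  (forall A, measurable A -> m1 (t1 @^-1` A) = m1 A) ->
  (forall A, measurable A -> m2 (t2 @^-1` A) = m2 A) ->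
  forall A, measurable A ->
    sfprod m1 m2 ((fun z => (t1 z.1, t2 z.2)) @^-1` A) = sfprod m1 m2 A.
Proof.
move=> mt1 mt2 t1E t2E A mA.
pose t (z : T1 * T2) := (t1 z.1, t2 z.2).
have mt : measurable_fun setT t.
  by apply: measurable_fun_pair; exact: measurableT_comp.
pose m := pushforward (sfprod m1 m2) t.
have mE : forall B C, measurable B -> measurable C -> m (B `*` C) = m1 B * m2 C.
  move=> B C mB mC.
  have -> : m (B `*` C) = (m1 \x m2) ((t1 @^-1` B) `*` (t2 @^-1` C)) by [].
  have mB1 : measurable (t1 @^-1` B) by rewrite -[_ @^-1` _]setTI; exact: mt1.
  have mC2 : measurable (t2 @^-1` C) by rewrite -[_ @^-1` _]setTI; exact: mt2.
  rewrite product_measure1E//.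
  by congr (_ * _); [exact: t1E|exact: t2E].
exact: (esym (product_measure_unique mE mA)).
Qed.

End translation.

Lemma integral_probability_cst d (T : measurableType d) (R : realType)
  (P : probability T R) (c : \bar R) : (\int[P]_x c = c)%E.
Proof. by rewrite integral_cst//= probability_setT mule1. Qed.

(** * Lebesgue measure on space *)

Local Notation M3 R :=
  (measurableTypeR R * measurableTypeR R * measurableTypeR R)%type.

HB.lock Definition leb3 (R : realType) :
    {sigma_finite_measure set (M3 R) -> \bar R} :=
  sfprod (sfprod (@lebesgue_measure R) (@lebesgue_measure R))
    (@lebesgue_measure R).

Section space.
Variable R : realType.
Local Notation T3 := (M3 R).
Local Notation leb3 := (leb3 R).

(** Measurability and integration take place on [R * R * R], geometry on rows;
    [vec] and [cds] are the two inverse identifications. *)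
Definition vec (p : R * R * R) : 'rV[R]_3 :=
  \row_i nth 0 [:: p.1.1; p.1.2; p.2] i.

Definition cds (x : 'rV[R]_3) : R * R * R :=
  (x 0 (inord 0), x 0 (inord 1), x 0 (inord 2)).

Lemma vecK : cancel vec cds.
Proof. by move=> [[a b] c]; rewrite /cds /vec !mxE !inordK. Qed.

Lemma cdsK : cancel cds vec.
Proof.
move=> x; apply/rowP => i; rewrite mxE /=.
case: i => -[|[|[|//]]] i3 /=; congr (x _ _); apply/val_inj; by rewrite /= inordK.
Qed.

(** Rows are not given a sigma-algebra; this is measurability for the one that
    [cds] carries over from [R * R * R]. *)
Definition mvec d (T : measurableType d) (h : T -> 'rV[R]_3) :=
  forall i, measurable_fun setT (fun t => h t 0 i).

Lemma mvec_cds d (T : measurableType d) (h : T -> 'rV[R]_3) :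
  mvec h -> measurable_fun setT (cds \o h).
Proof. by move=> mh; do 2 (apply: measurable_fun_pair => //). Qed.

Lemma mvec_comp d (T : measurableType d) d' (U : measurableType d')
    (h : T -> 'rV[R]_3) (F : 'rV[R]_3 -> U) :
  mvec h -> measurable_fun setT (F \o vec) -> measurable_fun setT (F \o h).
Proof.
move=> mh mF; rewrite (_ : F \o h = (F \o vec) \o (cds \o h)).
  exact: measurableT_comp (mvec_cds mh).
by apply/funext => t /=; rewrite cdsK.
Qed.

Lemma mvec_vec : mvec vec.
Proof.
case=> -[|[|[|//]]] i3.
- rewrite (_ : (fun _ => _) = fst \o fst); last by apply/funext => p; rewrite mxE.
  exact: measurableT_comp.
- rewrite (_ : (fun _ => _) = snd \o fst); last by apply/funext => p; rewrite mxE.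
  exact: measurableT_comp.
- rewrite (_ : (fun _ => _) = snd); last by apply/funext => p; rewrite mxE.
  exact: measurable_snd.
Qed.

Lemma mvec_fst d d' (T : measurableType d) (U : measurableType d') (h : T -> 'rV[R]_3) :
  mvec h -> mvec (fun z : T * U => h z.1).
Proof. by move=> mh i; apply: (measurableT_comp (mh i)). Qed.

Lemma mvec_snd d d' (T : measurableType d) (U : measurableType d') (h : U -> 'rV[R]_3) :
  mvec h -> mvec (fun z : T * U => h z.2).
Proof. by move=> mh i; apply: (measurableT_comp (mh i)). Qed.

Lemma mvecD d (T : measurableType d) (h k : T -> 'rV[R]_3) :
  mvec h -> mvec k -> mvec (fun t => h t + k t).
Proof.
move=> mh mk i; under eq_fun do rewrite mxE.
by apply: measurable_funD; [exact: mh|exact: mk].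
Qed.

Lemma mvec_cst d (T : measurableType d) (a : 'rV[R]_3) : mvec (fun _ : T => a).
Proof. by move=> i; exact: measurable_cst. Qed.

Lemma mvecZ d (T : measurableType d) (s : T -> R) (h : T -> 'rV[R]_3) :
  measurable_fun setT s -> mvec h -> mvec (fun t => s t *: h t).
Proof.
move=> ms mh i; under eq_fun do rewrite mxE.
by apply: measurable_funM => //; exact: mh.
Qed.

Lemma mvecM d (T : measurableType d) (h : T -> 'rV[R]_3) (A : 'M[R]_3) :
  mvec h -> mvec (fun t => h t *m A).
Proof.
move=> mh i; under eq_fun do rewrite mxE sum_ord3.
do 2 (apply: measurable_funD; last by apply: measurable_funM => //; exact: mh).
by apply: measurable_funM => //; exact: mh.
Qed.

Lemma measurable_dot d (T : measurableType d) (h k : T -> 'rV[R]_3) :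
  mvec h -> mvec k -> measurable_fun setT (fun t => dot (h t) (k t)).
Proof.
move=> mh mk; under eq_fun do rewrite dotE sum_ord3.
by do 2 (apply: measurable_funD; last exact: measurable_funM);
  exact: measurable_funM.
Qed.

Lemma leb3_translation (a : 'rV[R]_3) (A : set T3) : measurable A ->
  leb3 ((fun p => cds (vec p + a)) @^-1` A) = leb3 A.
Proof.
move=> mA; rewrite leb3.unlock; have tr := @lebesgue_measure_translation R.
have mt (b : R) : measurable_fun setT (fun x : measurableTypeR R => x + b).
  exact: measurable_funD.
have tr2 := @product_measure_translation _ _ _ _ _ _ _ _ _
  (mt (a 0 (inord 0))) (mt (a 0 (inord 1)))
  (tr (a 0 (inord 0))) (tr (a 0 (inord 1))).
have mt2 : measurable_fun setT (fun z : measurableTypeR R * measurableTypeR R =>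
    (z.1 + a 0 (inord 0), z.2 + a 0 (inord 1))).
  by apply: measurable_fun_pair; apply: measurable_funD.
rewrite -[RHS](product_measure_translation mt2 (mt (a 0 (inord 2))) tr2
  (tr (a 0 (inord 2))))//.
congr (sfprod _ _ (_ @^-1` A)); apply/funext => p.
by rewrite /cds !mxE !inordK.
Qed.

Local Open Scope ereal_scope.

Lemma integral_leb3_translation (a : 'rV[R]_3) (f : 'rV[R]_3 -> \bar R) :
  measurable_fun setT (f \o vec) -> (forall x, 0 <= f x) ->
  \int[leb3]_p f (vec p + a)%R = \int[leb3]_p f (vec p).
Proof.
move=> mf f0; pose t p : T3 := cds (vec p + a)%R.
have mt : measurable_fun setT t.
  by apply: mvec_cds; apply: mvecD; [exact: mvec_vec|exact: mvec_cst].
transitivity (\int[pushforward leb3 t]_p (f \o vec) p); last first.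
  by apply: eq_measure_integral => /= B mB _; exact: leb3_translation.
rewrite ge0_integral_pushforward//; last by move=> p _; exact: f0.
by apply: eq_integral => p _ /=; rewrite /t cdsK.
Qed.

(** Any linear change of variables multiplies Lebesgue measure by a constant,
    and the constant can be read off on a single even function g.  In the
    double integral of f(x) g(y A), translate x by y A, exchange the order of
    integration, and translate y by - x A^-1: the integrand becomes
    f(y A) g(y A - x), and g is even. *)
Lemma integral_leb3_linear (A : 'M[R]_3) (f g : 'rV[R]_3 -> \bar R) :
  A \in unitmx ->
  measurable_fun setT (f \o vec) -> (forall x, 0 <= f x) ->
  measurable_fun setT (g \o vec) -> (forall x, 0 <= g x) ->
  (forall x, g (- x)%R = g x) ->
  \int[leb3]_p f (vec p) * \int[leb3]_p g (vec p *m A) =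
  \int[leb3]_p f (vec p *m A) * \int[leb3]_p g (vec p).
Proof.
move=> uA mf f0 mg g0 gN.
have mv := mvec_vec.
have mf1 h : mvec h -> measurable_fun setT (fun p : T3 => f (h p)).
  by move=> mh; exact: (mvec_comp mh mf).
have mg1 h : mvec h -> measurable_fun setT (fun p : T3 => g (h p)).
  by move=> mh; exact: (mvec_comp mh mg).
have mf2 h : mvec h -> measurable_fun setT (fun p : T3 * T3 => f (h p)).
  by move=> mh; exact: (mvec_comp mh mf).
have mg2 h : mvec h -> measurable_fun setT (fun p : T3 * T3 => g (h p)).
  by move=> mh; exact: (mvec_comp mh mg).
have mvA : mvec (fun p => vec p *m A) by exact: mvecM.
have mv1 : mvec (fun p : T3 * T3 => vec p.1) by exact: mvec_fst.
have mv2 : mvec (fun p : T3 * T3 => vec p.2) by exact: mvec_snd.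
have mvA2 : mvec (fun p : T3 * T3 => vec p.2 *m A) by exact: mvecM.
have fin0 : 0 <= \int[leb3]_p f (vec p) by exact: integral_ge0.
rewrite -ge0_integralZl//; last exact: mg1.
transitivity (\int[leb3]_q \int[leb3]_p (f (vec p + vec q *m A)%R * g (vec q *m A))).
  apply: eq_integral => q _; rewrite -(integral_leb3_translation (vec q *m A))//.
  rewrite ge0_integralZr//; apply: mf1; apply: mvecD => //; exact: mvec_cst.
rewrite -(fubini_tonelli (fun z : T3 * T3 =>
  f (vec z.1 + vec z.2 *m A)%R * g (vec z.2 *m A)))/=; last 2 first.
- apply: emeasurable_funM; [by apply: mf2; exact: mvecD|exact: mg2].
- by move=> z; exact: mule_ge0.
transitivity (\int[leb3]_p \int[leb3]_q (f (vec q *m A) * g (vec q *m A - vec p)%R)).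
  apply: eq_integral => p _.
  rewrite -(integral_leb3_translation (- vec p *m invmx A)
    (f := fun y => f (vec p + y *m A)%R * g (y *m A)))//.
  - by apply: eq_integral => q _; rewrite mulmxDl mulmxKV// addrCA subrr addr0.
  - rewrite /comp; apply: emeasurable_funM; last exact: mg1.
    by apply: mf1; apply: mvecD => //; exact: mvec_cst.
  - by move=> y; exact: mule_ge0.
rewrite (fubini_tonelli (fun z : T3 * T3 =>
  f (vec z.2 *m A) * g (vec z.2 *m A - vec z.1)%R))/=; last 2 first.
- apply: emeasurable_funM; first exact: mf2.
  apply: mg2; apply: mvecD => //.
  under [X in mvec X]eq_fun do rewrite -scaleN1r.
  by apply: mvecZ => //; exact: measurable_cst.
- by move=> z; exact: mule_ge0.
rewrite -ge0_integralZr//; last 2 first.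
- exact: mf1.
- exact: integral_ge0.
apply: eq_integral => q _; rewrite ge0_integralZl//; last first.
  apply: mg1; apply: mvecD => //.
  by under [X in mvec X]eq_fun do rewrite -scaleN1r; exact: mvecZ.
congr (_ * _).
rewrite -(integral_leb3_translation (- (vec q *m A)) (f := g))//.
by apply: eq_integral => p _; rewrite -gN opprB.
Qed.

End space.

(** * Isotropic normal laws *)

HB.lock Definition normal3 (R : realType) (mu : 'rV[R]_3) (sigma : R) :
    probability (M3 R) R :=
  let N i := normal_law (mu 0 i) sigma in
  ((N (inord 0) \x N (inord 1)) \x N (inord 2))%E.

Section normal3.
Variable R : realType.
Local Notation T3 := (M3 R).
Implicit Types (mu x y : 'rV[R]_3) (sigma : R).

Definition normal3_pdf sigma x : R :=
  normal_peak sigma ^+ 3 * expR (- dot x x / (sigma ^+ 2 *+ 2)).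

Lemma normal3_pdf_gt0 sigma x : sigma != 0 -> 0 < normal3_pdf sigma x.
Proof. by move=> s0; rewrite mulr_gt0 ?expR_gt0// exprn_gt0// normal_peak_gt0. Qed.

Lemma measurable_normal3_pdf d (T : measurableType d) sigma (h : T -> 'rV[R]_3) :
  mvec h -> measurable_fun setT (fun t => normal3_pdf sigma (h t)).
Proof.
move=> mh; apply: measurable_funM => //; apply: measurableT_comp => //.
apply: measurable_funM => //; apply: measurableT_comp => //.
exact: measurable_dot.
Qed.

Lemma normal_law_density (m sigma : R) A : sigma != 0 ->
  measurable A -> normal_law m sigma A =
  (\int[lebesgue_measure]_(x in A) (normal_pdf m sigma x)%:E)%E.
Proof. by move=> s0 mA; rewrite /normal_law (negbTE s0). Qed.

(** The density of the product is the product of the densities, and the squares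
    of the coordinates in the exponents add up to the squared norm. *)
Lemma normal3_density mu sigma (A : set T3) : sigma != 0 -> measurable A ->
  normal3 mu sigma A =
  (\int[leb3 R]_(p in A) (normal3_pdf sigma (vec p - mu))%:E)%E.
Proof.
move=> s0 mA; pose f i := normal_pdf (mu 0 i) sigma.
have mf i : measurable_fun (setT : set (measurableTypeR R)) (f i).
  exact: measurable_normal_pdf.
have f0 i (t : R) : 0 <= f i t by exact: normal_pdf_ge0.
have fE i (B : set (measurableTypeR R)) : measurable B -> _ :=
  @normal_law_density (mu 0 i) sigma B s0.
have mf2 : measurable_fun setT (fun z : measurableTypeR R * measurableTypeR R =>
    f (inord 0) z.1 * f (inord 1) z.2).
  by apply: measurable_funM; apply: (measurableT_comp (mf _)).
have f20 (z : measurableTypeR R * measurableTypeR R) :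
  0 <= f (inord 0) z.1 * f (inord 1) z.2 by rewrite mulr_ge0.
have fE2 := product_density (mf (inord 0)) (f0 _)
  (mf (inord 1)) (f0 _) (fE (inord 0)) (fE (inord 1)).
pose N01 : probability (measurableTypeR R * measurableTypeR R)%type R :=
  (normal_law (mu 0%R (inord 0)) sigma \x normal_law (mu 0%R (inord 1)) sigma)%E.
have := product_density (m1 := sfprod (@lebesgue_measure R) (@lebesgue_measure R))
  (n1 := N01)
  mf2 f20 (mf (inord 2)) (f0 _) fE2 (fE (inord 2)) mA.
move=> H; rewrite normal3.unlock leb3.unlock; apply: (eq_trans H).
apply: eq_integral => p _; congr (_%:E).
rewrite /f !normal_pdfE// /normal3_pdf /normal_fun.
have -> : - dot (vec p - mu) (vec p - mu) =
    - (p.1.1 - mu 0 (inord 0)) ^+ 2 - (p.1.2 - mu 0 (inord 1)) ^+ 2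
    - (p.2 - mu 0 (inord 2)) ^+ 2.
  by rewrite dotE sum_ord3 !mxE !inordK//= !opprD -!expr2.
by rewrite 2!mulrDl !expRD; ring.
Qed.

Let dir mu i : probability (measurableTypeR R) R :=
  @dirac _ (measurableTypeR R) (mu 0 (inord i)) R.

Local Open Scope ereal_scope.

Lemma integral_normal3 mu sigma (F : 'rV[R]_3 -> \bar R) : sigma != 0%R ->
  measurable_fun setT (F \o @vec R) -> (forall x, 0 <= F x) ->
  \int[normal3 mu sigma]_p F (vec p) =
  \int[leb3 R]_p (F (vec p) * (normal3_pdf sigma (vec p - mu))%:E).
Proof.
move=> s0 mF F0.
rewrite (ge0_integral_density (mu := leb3 R)
  (p := fun p => normal3_pdf sigma (vec p - mu)))//.
- apply: measurable_normal3_pdf; apply: mvecD; first exact: mvec_vec.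
  exact: mvec_cst.
- by move=> p; rewrite ltW// normal3_pdf_gt0.
- by move=> A mA; exact: normal3_density.
Qed.

Lemma normal3_dirac mu (A : set T3) : measurable A ->
  normal3 mu 0 A = \d_(cds mu) A.
Proof.
move=> mA; rewrite normal3.unlock /normal_law eqxx.
pose T2 := (measurableTypeR R * measurableTypeR R)%type.
have d2 (B : set T2) : measurable B ->
    (dir mu 0 \x dir mu 1) B = @dirac _ T2 (cds mu).1 R B.
  move=> mB; apply: (@product_measure_unique _ _ _ _ _ (dir mu 0) (dir mu 1)
    (@dirac _ T2 (cds mu).1 R) _ B mB) => C D mC mD; rewrite /dir/= /dirac/= !indicE.
  by rewrite in_setX/=; do 2 case: (_ \in _); rewrite ?mule1 ?mule0.
pose dir01 : probability T2 R :=
  (dir mu 0 \x dir mu 1).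
apply: (@product_measure_unique _ _ _ _ _ dir01 (dir mu 2) (@dirac _ T3 (cds mu) R)
  _ A mA) => C D mC mD.
rewrite [X in _ = X * _](d2 _ mC) /dir/= /dirac/= !indicE.
by rewrite in_setX/=; do 2 case: (_ \in _); rewrite ?mule1 ?mule0.
Qed.

(** A rotation and a rescaling turn the centred normal density of variance
    sigma^2 into a multiple c of the standard one.  The change of variables of
    [integral_leb3_linear], calibrated on that density itself, has the same
    constant c, which cancels.  For sigma = 0 the law is a point mass. *)
Lemma integral_normal3_std mu sigma A (F : 'rV[R]_3 -> \bar R) : orthomx A ->
  measurable_fun setT (F \o @vec R) -> (forall x, 0 <= F x) ->
  \int[normal3 mu sigma]_p F (vec p) =
  \int[normal3 0 1]_p F (mu + sigma *: (vec p *m A))%R.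
Proof.
move=> oA mF F0; have mv := @mvec_vec R.
have [->|s0] := eqVneq sigma 0%R.
  under [RHS]eq_integral do rewrite scale0r addr0.
  transitivity (F mu); last first.
    exact/esym/integral_probability_cst.
  transitivity (\int[@dirac _ T3 (cds mu) R]_p F (vec p)).
    by apply: eq_measure_integral => /= B mB _; exact: normal3_dirac.
  by rewrite integral_dirac// diracT mul1e cdsK.
have mFh h : @mvec R _ T3 h -> measurable_fun setT (fun p => F (h p)).
  by move=> mh; exact: (mvec_comp mh mF).
have mphi s h : @mvec R _ T3 h ->
    measurable_fun setT (fun p => (normal3_pdf s (h p))%:E).
  by move=> mh; exact/measurable_EFinP/measurable_normal3_pdf.
have phi0 s x : s != 0%R -> 0 <= (normal3_pdf s x)%:E.
  by move=> ?; rewrite lee_fin ltW// normal3_pdf_gt0.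
have phi1 s : s != 0%R -> \int[leb3 R]_p (normal3_pdf s (vec p))%:E = 1.
  move=> s1; transitivity (normal3 0 s setT); last exact: probability_setT.
  rewrite (normal3_density 0 s1 measurableT).
  by under [RHS]eq_integral do rewrite subr0.
have mFs : mvec (fun p : T3 => mu + sigma *: (vec p *m A))%R.
  apply: mvecD; first exact: mvec_cst.
  by apply: mvecZ => //; exact: mvecM.
pose c : R := (normal_peak sigma ^+ 3 / normal_peak 1 ^+ 3)%R.
have p1 : (0 < normal_peak (1 : R))%R by rewrite normal_peak_gt0// oner_eq0.
have c0 : (0 < c)%R by rewrite divr_gt0// exprn_gt0// normal_peak_gt0.
have phiA x : (normal3_pdf sigma (x *m (sigma *: A)) = c * normal3_pdf 1 x)%R.
  rewrite /normal3_pdf /c mulrA divfK ?gt_eqF ?exprn_gt0//.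
  rewrite -scalemxAr dotZ dot_orthomx// -expr2; congr (_ * expR _)%R.
  by rewrite expr1n mulNr -mulrnAr; field; rewrite s0.
have sA : sigma *: A \in unitmx by rewrite unitmxZ ?unitfE// orthomx_unit.
rewrite (integral_normal3 _ s0 mF F0).
rewrite (integral_normal3 0 (F := fun x => F (mu + sigma *: (x *m A))%R)
  (oner_neq0 R) (mFh _ mFs) (fun _ => F0 _)).
pose f x := F (mu + x)%R * (normal3_pdf sigma x)%:E.
have mf : measurable_fun setT (f \o @vec R).
  apply: emeasurable_funM; last exact: mphi.
  by apply: mFh; apply: mvecD => //; exact: mvec_cst.
have f0 x : 0 <= f x by rewrite /f mule_ge0 ?phi0.
have EgA : \int[leb3 R]_p (normal3_pdf sigma (vec p *m (sigma *: A)))%:E = c%:E.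
  under eq_integral do rewrite phiA EFinM.
  rewrite ge0_integralZl ?lee_fin ?(ltW c0)//.
  - by rewrite phi1 ?mule1 ?oner_eq0.
  - exact: mphi.
  - by move=> p _; rewrite phi0 ?oner_eq0.
have EfA : \int[leb3 R]_p f (vec p *m (sigma *: A)) =
    c%:E * \int[leb3 R]_p (F (mu + sigma *: (vec p *m A))%R *
      (normal3_pdf 1 (vec p - 0))%:E).
  rewrite -ge0_integralZl ?lee_fin ?(ltW c0)//.
  - apply: eq_integral => p _.
    by rewrite /f phiA EFinM muleCA subr0 -scalemxAr.
  - under eq_fun do rewrite subr0.
    by apply: emeasurable_funM; [exact: mFh|exact: mphi].
  - by move=> p _; rewrite mule_ge0 ?phi0 ?oner_eq0.
have Ef : \int[leb3 R]_p f (vec p) =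
    \int[leb3 R]_p (F (vec p) * (normal3_pdf sigma (vec p - mu))%:E).
  rewrite -(integral_leb3_translation mu
    (f := fun x => F x * (normal3_pdf sigma (x - mu))%:E)).
  - by apply: eq_integral => p _; rewrite /f addrK addrC.
  - apply: emeasurable_funM; first exact: mFh.
    by apply: mphi; apply: mvecD => //; exact: mvec_cst.
  - by move=> x; rewrite mule_ge0 ?phi0.
have phiN x : (normal3_pdf sigma (- x))%:E = (normal3_pdf sigma x)%:E.
  by rewrite /normal3_pdf dotNN.
have H := integral_leb3_linear sA mf f0 (mphi sigma _ mv)
  (fun x => phi0 sigma x s0) phiN.
have cK (z : \bar R) : (c^-1)%:E * (c%:E * z) = z.
  by rewrite muleA -EFinM (mulVf (lt0r_neq0 c0)) mul1e.
(* The constant c appears on both sides of the change of variables. *)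
have solve (I IgA IfA Ig J : \bar R) : I * IgA = IfA * Ig -> IgA = c%:E ->
    IfA = c%:E * J -> Ig = 1 -> I = J.
  move=> H1 H2 H3 H4; move: H1.
  by rewrite H2 H3 H4 mule1 muleC => /(can_inj cK).
exact: (eq_trans (esym Ef) (solve _ _ _ _ _ H EgA EfA (phi1 _ s0))).
Qed.

End normal3.

(** * Expectations under a law *)

Section probability_integrals.
Context d (T : measurableType d) (R : realType) (P : probability T R).

Lemma bounded_integrable (h : T -> R) (M : R) : measurable_fun setT h ->
  (forall x, `|h x| <= M) -> P.-integrable setT (EFin \o h).
Proof.
move=> mh hM; apply: measurable_bounded_integrable => //.
  by rewrite (le_lt_trans (probability_le1 _ _))// ltry.
exists M; split; first by rewrite num_real.
by move=> t Mt x _ /=; rewrite (le_trans (hM x))// ltW.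
Qed.

Lemma EFin_Rintegral (h : T -> R) : P.-integrable setT (EFin \o h) ->
  (\int[P]_x (h x)%:E)%E = (\int[P]_x h x)%:E.
Proof. by move=> ih; rewrite /Rintegral fineK//; exact: integrable_fin_num. Qed.

(** A nonnegative function of zero integral vanishes almost everywhere. *)
Lemma Rintegral_gt0 (h : T -> R) : P.-integrable setT (EFin \o h) ->
  (forall x, 0 <= h x) -> measurable [set x | h x = 0] ->
  P [set x | h x = 0] = 0%E -> 0 < \int[P]_x h x.
Proof.
move=> ih h0 mh0 Ph0; rewrite lt_neqAle Rintegral_ge0// andbT eq_sym.
apply/eqP => ih0.
have mh := measurable_int _ ih.
have : (\int[P]_x `|(EFin \o h) x| = 0)%E.
  under eq_integral do rewrite /= ger0_norm//.
  by rewrite EFin_Rintegral// ih0.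
move/(ae_eq_integral_abs P measurableT mh).1 => [N [mN PN0 hN]].
pose Z := [set x | h x = 0].
have : (P [set: T] <= P N + P Z)%E.
  apply: le_trans (measureU2 _ mN mh0); apply: le_measure; rewrite ?inE//.
    exact: measurableU.
  move=> x _; have [hx|hx] := pselect (h x = 0); [by right|left].
  by apply: hN => /= /(_ I)[].
by rewrite PN0 Ph0 adde0 probability_setT lee_fin ler10.
Qed.

End probability_integrals.

Lemma integral_law d d' (T : measurableType d) (U : measurableType d')
  (R : realType) (P : {measure set T -> \bar R}) (Q : {measure set U -> \bar R})
  (h : T -> U) (F : U -> \bar R) :
  measurable_fun setT h -> (forall B, measurable B -> Q B = P (h @^-1` B)) ->
  measurable_fun setT F -> P.-integrable setT (F \o h) ->
  (\int[Q]_y F y = \int[P]_x F (h x))%E.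
Proof.
move=> mh QE mF iF; transitivity (\int[pushforward P h]_y F y)%E.
  by apply: eq_measure_integral => B mB _; exact: QE.
by rewrite integral_pushforward.
Qed.

Section normal3_laws.
Variable R : realType.
Local Notation T3 := (M3 R).
Implicit Types (mu x y : 'rV[R]_3) (sigma : R) (A : 'M[R]_3).

Lemma mvec_std mu sigma A : @mvec R _ T3 (fun p => mu + sigma *: (vec p *m A)).
Proof.
apply: mvecD; first exact: mvec_cst.
by apply: mvecZ => //; apply: mvecM; exact: mvec_vec.
Qed.

Lemma normal3_std mu sigma A (B : set T3) : orthomx A -> measurable B ->
  normal3 mu sigma B =
  normal3 0 1 ((fun p => cds (mu + sigma *: (vec p *m A))) @^-1` B).
Proof.
move=> oA mB; pose F x : \bar R := (\1_B (cds x))%:E.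
have mF : measurable_fun setT (F \o @vec R).
  rewrite (_ : _ \o _ = (fun p => (\1_B p)%:E)); first exact/measurable_EFinP.
  by apply/funext => p; rewrite /F /= vecK.
have F0 x : (0 <= F x)%E by rewrite lee_fin.
have mT := mvec_cds (mvec_std mu sigma A).
have := integral_normal3_std mu sigma oA mF F0.
rewrite /F; under eq_integral do rewrite vecK.
rewrite integral_indic// setIT => ->.
have mTB : measurable ((fun p : T3 => cds (mu + sigma *: (vec p *m A))) @^-1` B).
  by rewrite -[_ @^-1` _]setTI; exact: mT.
have := integral_indic (normal3 0 1) measurableT mTB.
by rewrite setIT => <-.
Qed.

Lemma expect_normal3_std mu sigma A (F : 'rV[R]_3 -> R) (M : R) : orthomx A ->
  measurable_fun setT (F \o @vec R) -> (forall x, `|F x| <= M) ->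
  (\int[normal3 mu sigma]_p (F (vec p)))%R =
  (\int[normal3 0 1]_p (F (mu + sigma *: (vec p *m A))))%R.
Proof.
move=> oA mF FM; congr fine.
have FTE : EFin \o (fun p : T3 => F (mu + sigma *: (vec p *m A))) =
    (EFin \o (F \o @vec R)) \o (fun p => cds (mu + sigma *: (vec p *m A))).
  by apply/funext => p /=; rewrite cdsK.
rewrite (@integral_law _ _ _ _ _ (normal3 0 1) (normal3 mu sigma)
  (fun p => cds (mu + sigma *: (vec p *m A))) (EFin \o (F \o @vec R))).
- by apply: eq_integral => p _ /=; rewrite cdsK.
- exact: mvec_cds (mvec_std mu sigma A).
- by move=> B mB; exact: normal3_std.
- exact/measurable_EFinP.
- rewrite -FTE; apply: (@bounded_integrable _ _ _ _ _ M) => [|p]; last exact: FM.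
  exact: (mvec_comp (mvec_std mu sigma A) mF).
Qed.

Lemma expect_isotropic d (T : measurableType d) (P : probability T R)
  (X : T -> 'rV[R]_3) mu sigma (F : 'rV[R]_3 -> R) (M : R) :
  isotropic_normal P X mu sigma ->
  measurable_fun setT (F \o @vec R) -> (forall x, `|F x| <= M) ->
  ('E_P[fun t => F (X t)] = (\int[normal3 mu sigma]_p F (vec p))%R%:E)%E.
Proof.
move=> [mX XE] mF FM; rewrite unlock -EFin_Rintegral; last first.
  by apply: (@bounded_integrable _ _ _ _ _ M) => // p; exact: FM.
have FXE : (fun t => (F (X t))%:E) = (EFin \o (F \o @vec R)) \o (@cds R \o X).
  by apply/funext => t /=; rewrite cdsK.
rewrite (@integral_law _ _ _ _ _ P (normal3 mu sigma) (@cds R \o X)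
  (EFin \o (F \o @vec R))).
- by apply: eq_integral => t _ /=; rewrite cdsK.
- exact: mX.
- by move=> B mB; rewrite normal3.unlock; apply/esym/XE.
- exact/measurable_EFinP.
- rewrite -FXE; apply: (@bounded_integrable _ _ _ _ _ M) => [|t]; last exact: FM.
  rewrite (_ : (fun t => _) = (F \o @vec R) \o (@cds R \o X)).
    exact: (measurableT_comp mF mX).
  by apply/funext => t /=; rewrite cdsK.
Qed.

Lemma normal3_fst_null (t : R) : normal3 0 1 [set p : T3 | p.1.1 = t] = 0%E.
Proof.
have -> : [set p : T3 | p.1.1 = t] = ([set t] `*` setT) `*` setT.
  by apply/seteqP; split=> [[[a b] c]//=|[[a b] c]/= [[]]].
have mt : measurable ([set t] : set (measurableTypeR R)) by exact: measurable_set1.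
rewrite normal3.unlock.
pose N i := normal_law ((0 : 'rV[R]_3) 0 i) 1.
pose N01 : probability (measurableTypeR R * measurableTypeR R)%type R :=
  (N (inord 0) \x N (inord 1))%E.
have E01 : N01 ([set t] `*` setT) = 0%E.
  rewrite [LHS](@product_measure1E _ _ _ _ _ (N (inord 0)) (N (inord 1)))//.
  rewrite [X in (X * _)%E](_ : _ = 0%E) ?mul0e//.
  by rewrite /N /normal_law oner_eq0/= /normal_prob integral_set1.
rewrite [LHS](@product_measure1E _ _ _ _ _ N01 (N (inord 2)))//.
  by rewrite [X in (X * _)%E]E01 mul0e.
exact: measurableX.
Qed.

(** By rotating the normal vector x of the plane onto the first axis, the event
    becomes that a real normal variable takes a prescribed value. *)
Lemma normal3_hyperplane mu sigma x : sigma != 0 -> x != 0 ->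
  normal3 mu sigma [set p | dot (vec p) x = 0] = 0%E.
Proof.
move=> s0 x0; pose A := householder (e1 R) (pr x).
have oA : orthomx A by exact: householder_orthomx.
have m0 : measurable [set p : T3 | dot (vec p) x = 0].
  have mdot : measurable_fun setT (fun p : T3 => dot (vec p) x).
    by apply: measurable_dot; [exact: mvec_vec|exact: mvec_cst].
  by have := mdot measurableT _ (measurable_set1 0); rewrite setTI.
rewrite (normal3_std _ _ oA m0).
have s1 : sigma * enorm x != 0 by rewrite mulf_neq0// enorm_eq0.
rewrite (_ : _ @^-1` _ = [set p : T3 | p.1.1 = - dot mu x / (sigma * enorm x)]).
  exact: normal3_fst_null.
have dx (p : T3) : dot (mu + sigma *: (vec p *m A)) x =
    dot mu x + sigma * enorm x * p.1.1.
  rewrite dotDl dotZl [in X in _ * X](enorm_scale_pr x) dotZr mulrA.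
  rewrite -(householder_e1 (pr_sphere x0)) dot_orthomx// dot_e1.
  by rewrite mxE inordK.
apply/seteqP; split=> p /=; rewrite cdsK dx.
  move/eqP; rewrite addrC addr_eq0 => /eqP dE.
  by apply: (mulIf s1); rewrite divfK// -dE mulrC.
by move=> ->; rewrite mulrC divfK// addrN.
Qed.

End normal3_laws.

(** * The intrinsic mean *)

Section measurability.
Variable R : realType.

Lemma measurable_invr : measurable_fun [set: R] (@GRing.inv R).
Proof.
have -> : [set: R] = [set~ 0] `|` [set 0] by rewrite setUC setUv.
apply/measurable_funU; [exact: measurableC|exact: measurable_set1|split].
  apply: open_continuous_measurable_fun; first by rewrite openC; exact: closed_eq.
  by move=> x /set_mem /= x0; apply: inv_continuous; apply/eqP.
exact: measurable_fun_set1.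
Qed.

Lemma measurable_sqrt : measurable_fun [set: R] (@Num.sqrt R).
Proof. by apply: nondecreasing_measurable => // x y; exact: ler_wsqrtr. Qed.

Lemma lt_acos (a b : R) : -1 <= a -> a < b -> b <= 1 -> acos b < acos a.
Proof.
move=> a1 ab b1.
have aI : -1 <= a <= 1 by rewrite a1 (le_trans (ltW ab)).
have bI : -1 <= b <= 1 by rewrite b1 (le_trans a1 (ltW ab)).
by rewrite -ltr_cos ?in_itv/= ?acos_ge0 ?acos_lepi// !acosK ?in_itv.
Qed.

Lemma measurable_acos d (T : measurableType d) (h : T -> R) :
  measurable_fun setT h -> (forall t, -1 <= h t <= 1) ->
  measurable_fun setT (fun t => acos (h t)).
Proof.
(* Clamping to [-1, 1] makes the inverse cosine monotone on the whole line. *)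
move=> mh h1; pose cl (x : R) := Num.max (-1) (Num.min 1 x).
have cl1 x : -1 <= cl x <= 1.
  by rewrite /cl le_max lexx/= ge_max ge_min lexx/= andbT; lra.
rewrite (_ : (fun _ => _) = (@acos R \o cl) \o h); last first.
  apply/funext => t /=; have /andP[ht1 ht2] := h1 t.
  by rewrite /cl (min_r ht2) (max_r ht1).
apply: measurableT_comp => //; apply: nonincreasing_measurable => // x y xy /=.
have : cl x <= cl y.
  rewrite /cl ge_max le_max lexx/= le_max; apply/orP; right.
  by rewrite le_min !ge_min lexx xy orbT.
rewrite le_eqVlt => /predU1P[->//|clxy].
by rewrite ltW// lt_acos//; [case/andP : (cl1 x)|case/andP: (cl1 y)].
Qed.

Lemma measurable_enorm d (T : measurableType d) (h : T -> 'rV[R]_3) :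
  mvec h -> measurable_fun setT (fun t => enorm (h t)).
Proof.
by move=> mh; apply: (measurableT_comp measurable_sqrt); exact: measurable_dot.
Qed.

Lemma mvec_pr d (T : measurableType d) (h : T -> 'rV[R]_3) :
  mvec h -> mvec (fun t => pr (h t)).
Proof.
move=> mh; apply: mvecZ => //.
by apply: (measurableT_comp measurable_invr); exact: measurable_enorm.
Qed.

Definition sqdist (q x : 'rV[R]_3) : R := sdist q (pr x) ^+ 2.

Lemma measurable_sqdist d (T : measurableType d) q (h : T -> 'rV[R]_3) :
  sphere q -> mvec h -> measurable_fun setT (fun t => sqdist q (h t)).
Proof.
move=> sq mh; apply: measurable_funX; apply: measurable_acos.
  by apply: measurable_dot; [exact: mvec_cst|exact: mvec_pr].
by move=> t; exact: dot_pr_le1.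
Qed.

Lemma sqdist_ge0 q x : 0 <= sqdist q x. Proof. exact: sqr_ge0. Qed.

Lemma sqdist_le q x : sphere q -> `|sqdist q x| <= pi ^+ 2.
Proof.
move=> sq; rewrite ger0_norm ?sqdist_ge0// lerXn2r ?nnegrE ?pi_ge0//.
  by rewrite acos_ge0// dot_pr_le1.
by rewrite acos_lepi// dot_pr_le1.
Qed.

(** The inverse cosine is decreasing, so the direction with the larger inner
    product with x is the closer one. *)
Lemma sqdist_lt q m x : sphere q -> sphere m -> dot x (m - q) > 0 ->
  sqdist m x < sqdist q x.
Proof.
move=> sq sm xmq.
have x0 : x != 0 by apply/eqP => x0; rewrite x0 dot0l ltxx in xmq.
have /andP[q1 _] := dot_pr_le1 x sq; have /andP[_ m1] := dot_pr_le1 x sm.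
have mq : dot q (pr x) < dot m (pr x).
  rewrite -subr_gt0 -dotNl -dotDl dotC /pr dotZl mulr_gt0// invr_gt0 enorm_gt0//.
rewrite /sqdist ltrXn2r ?nnegrE ?acos_ge0 ?dot_pr_le1//.
exact: lt_acos.
Qed.

End measurability.

Section mean.
Variable R : realType.
Local Notation T3 := (M3 R).
Implicit Types (mu x q m : 'rV[R]_3) (sigma : R) (A : 'M[R]_3).

(** The ratio of the densities of N(mu A, sigma^2 I) and N(mu, sigma^2 I) at x,
    for A orthogonal: the quadratic terms cancel. *)
Definition tilt mu sigma A x : R :=
  expR (dot x (mu *m A - mu) / sigma ^+ 2).

Lemma normal3_pdf_tilt mu sigma A x : sigma != 0 -> orthomx A ->
  normal3_pdf sigma (x - mu *m A) = tilt mu sigma A x * normal3_pdf sigma (x - mu).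
Proof.
move=> s0 oA; rewrite /normal3_pdf /tilt mulrCA -expRD; congr (_ * expR _).
have -> : dot (x - mu *m A) (x - mu *m A) =
    dot (x - mu) (x - mu) - 2 * dot x (mu *m A - mu).
  rewrite !(dotDl, dotDr, dotNl, dotNr) dot_orthomx//.
  rewrite (dotC (mu *m A) x) (dotC mu x); ring.
by field.
Qed.

Local Open Scope ereal_scope.

(** The image of N(mu, sigma^2 I) by A is N(mu A, sigma^2 I), whose density is
    [tilt] times the original one. *)
Lemma integral_normal3_tilt mu sigma A (F : 'rV[R]_3 -> \bar R) :
  sigma != 0%R -> orthomx A ->
  measurable_fun setT (F \o @vec R) -> (forall x, 0 <= F x) ->
  \int[normal3 mu sigma]_p F (vec p *m A) =
  \int[normal3 mu sigma]_p (F (vec p) * (tilt mu sigma A (vec p))%:E).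
Proof.
move=> s0 oA mF F0.
have o1 : orthomx (1%:M : 'M[R]_3) by rewrite /orthomx trmx1 mulmx1.
have mFA : measurable_fun setT ((fun x => F (x *m A)) \o @vec R).
  by apply: (mvec_comp _ mF); apply: mvecM; exact: mvec_vec.
rewrite (integral_normal3_std mu sigma o1 mFA (fun x => F0 _)).
transitivity (\int[normal3 (mu *m A) sigma]_p F (vec p)).
  rewrite [RHS](integral_normal3_std _ _ oA mF F0).
  by apply: eq_integral => p _; rewrite mulmx1 mulmxDl -scalemxAl.
have mw : measurable_fun setT (fun p : T3 => (tilt mu sigma A (vec p))%:E).
  apply/measurable_EFinP; apply: measurableT_comp => //.
  apply: measurable_funM => //.
  by apply: measurable_dot; [exact: mvec_vec|exact: mvec_cst].
rewrite (integral_normal3 _ s0 mF F0).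
rewrite (integral_normal3 mu (F := fun x => F x * (tilt mu sigma A x)%:E) s0).
- apply: eq_integral => p _; rewrite (normal3_pdf_tilt _ _ s0 oA).
  by rewrite EFinM muleA.
- exact: emeasurable_funM.
- by move=> x; rewrite mule_ge0// lee_fin expR_ge0.
Qed.

Local Open Scope ring_scope.

Lemma expect_normal3_tilt mu sigma A (F : 'rV[R]_3 -> R) (M : R) :
  sigma != 0 -> orthomx A -> measurable_fun setT (F \o @vec R) ->
  (forall x, 0 <= F x) -> (forall x, `|F x| <= M) ->
  (normal3 mu sigma).-integrable setT
    (EFin \o (fun p => F (vec p) * tilt mu sigma A (vec p))) /\
  (\int[normal3 mu sigma]_p F (vec p *m A))%R =
  (\int[normal3 mu sigma]_p (F (vec p) * tilt mu sigma A (vec p)))%R.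
Proof.
move=> s0 oA mF F0 FM.
have mEF : measurable_fun setT ((EFin \o F) \o @vec R) by exact/measurable_EFinP.
have E := @integral_normal3_tilt mu sigma A (EFin \o F) s0 oA mEF
  (fun x => F0 x).
have iFA : (normal3 mu sigma).-integrable setT (EFin \o (fun p => F (vec p *m A))).
  apply: (@bounded_integrable _ _ _ _ _ M) => [|p]; last exact: FM.
  by apply: (mvec_comp _ mF); apply: mvecM; exact: mvec_vec.
split; last by congr fine.
apply/integrableP; split.
  apply/measurable_EFinP/measurable_funM => //.
  apply: measurableT_comp => //; apply: measurable_funM => //.
  by apply: measurable_dot; [exact: mvec_vec|exact: mvec_cst].
under eq_integral do rewrite /= ger0_norm ?mulr_ge0 ?expR_ge0//.
move: iFA => /integrableP[_].
under [X in (X < _)%E -> _]eq_integral do rewrite /= ger0_norm//.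
by move=> FA; rewrite (le_lt_trans _ FA)// E.
Qed.

(** With A the reflection exchanging m and q, and w the tilt by A, one has
    E b = E (a w) and E a = E (b w), so that 2 (E b - E a) is the expectation of
    (b - a) (1 - w), which is positive off the plane of symmetry. *)
Lemma expect_sqdist_lt mu sigma q : mu != 0 -> sigma != 0 -> sphere q ->
  q != pr mu ->
  \int[normal3 mu sigma]_p sqdist (pr mu) (vec p) <
  \int[normal3 mu sigma]_p sqdist q (vec p).
Proof.
move=> mu0 s0 sq qm; set m := pr mu; have sm : sphere m by exact: pr_sphere.
set P := normal3 mu sigma.
pose A := householder m q; have oA : orthomx A by exact: householder_orthomx.
have mq : dot m m = dot q q by move/sphereE: sm => ->; move/sphereE: sq => ->.
have mA : m *m A = q by exact: householder_swap.
have qA : q *m A = m by exact: householder_swapr.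
pose a x := sqdist m x; pose b x := sqdist q x; pose w x := tilt mu sigma A x.
have maq r : sphere r -> measurable_fun setT (sqdist r \o @vec R).
  by move=> sr; apply: measurable_sqdist => //; exact: mvec_vec.
have [iaw Eaw] := expect_normal3_tilt mu s0 oA (maq m sm) (sqdist_ge0 m)
  (fun x => sqdist_le x sm).
have [ibw Ebw] := expect_normal3_tilt mu s0 oA (maq q sq) (sqdist_ge0 q)
  (fun x => sqdist_le x sq).
have ba x : sqdist m (x *m A) = b x.
  by rewrite /sqdist -qA pr_orthomx// sdist_orthomx.
have ab x : sqdist q (x *m A) = a x.
  by rewrite /sqdist -mA pr_orthomx// sdist_orthomx.
have ia : P.-integrable setT (EFin \o (fun p => a (vec p))).
  apply: (@bounded_integrable _ _ _ _ _ (pi ^+ 2)) => [|p]; last exact: sqdist_le.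
  exact: (maq m sm).
have ib : P.-integrable setT (EFin \o (fun p => b (vec p))).
  apply: (@bounded_integrable _ _ _ _ _ (pi ^+ 2)) => [|p]; last exact: sqdist_le.
  exact: (maq q sq).
have {}Eaw : \int[P]_p b (vec p) = \int[P]_p (a (vec p) * w (vec p)).
  by rewrite -Eaw; apply: eq_Rintegral => p _; rewrite ba.
have {}Ebw : \int[P]_p a (vec p) = \int[P]_p (b (vec p) * w (vec p)).
  by rewrite -Ebw; apply: eq_Rintegral => p _; rewrite ab.
pose h1 p := b (vec p) - a (vec p).
pose h2 p := b (vec p) * w (vec p) - a (vec p) * w (vec p).
have ih1 : P.-integrable setT (EFin \o h1).
  exact: (integrableB measurableT ib ia).
have ih2 : P.-integrable setT (EFin \o h2).
  exact: (integrableB measurableT ibw iaw).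
pose h p := h1 p - h2 p.
have ih : P.-integrable setT (EFin \o h).
  exact: (integrableB measurableT ih1 ih2).
have hE p : h p = (b (vec p) - a (vec p)) * (1 - w (vec p)).
  by rewrite /h /h1 /h2; ring.
have Eh : \int[P]_p h p = 2 * (\int[P]_p b (vec p) - \int[P]_p a (vec p)).
  rewrite RintegralB// /h1 /h2 !RintegralB// -Eaw -Ebw; ring.
suff : 0 < \int[P]_p h p by rewrite Eh pmulr_rgt0// subr_gt0.
have n0 : m - q != 0 by rewrite subr_eq0 eq_sym.
have wE x : w x = expR (- (enorm mu / sigma ^+ 2 * dot x (m - q))).
  rewrite /w /tilt [in mu *m A](enorm_scale_pr mu) -/m -scalemxAl mA.
  rewrite {2}(enorm_scale_pr mu) -/m -scalerBr dotZr -(opprB m) dotNr.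
  by congr expR; ring.
have c0 : 0 < enorm mu / sigma ^+ 2.
  by rewrite divr_gt0 ?enorm_gt0// exprn_even_gt0.
have hpos p : dot (vec p) (m - q) != 0 -> 0 < h p.
  rewrite hE wE neq_lt => /orP[lt0|gt0].
    rewrite nmulr_rgt0 ?subr_lt0.
      by rewrite -expR0 ltr_expR oppr_gt0 pmulr_rlt0.
    by apply: sqdist_lt => //; rewrite -opprB dotNr oppr_gt0.
  rewrite pmulr_rgt0 ?subr_gt0; last exact: sqdist_lt.
  by rewrite -[X in _ < X]expR0 ltr_expR oppr_lt0 pmulr_rgt0.
have h0 p : dot (vec p) (m - q) = 0 -> h p = 0.
  by move=> d0; rewrite hE wE d0 mulr0 oppr0 expR0 subrr mulr0.
have hZ : [set p | h p = 0] = [set p | dot (vec p) (m - q) = 0].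
  apply/seteqP; split => p /=; last exact: h0.
  by move=> hp; apply/eqP; apply: contra_eqT hp => /hpos; rewrite lt0r => /andP[].
apply: Rintegral_gt0 => //.
- move=> p; have [d0|/hpos/ltW//] := eqVneq (dot (vec p) (m - q)) 0.
  by rewrite h0.
- have /measurable_EFinP mh := measurable_int _ ih.
  by have := mh measurableT _ (measurable_set1 0); rewrite setTI.
- by rewrite hZ normal3_hyperplane.
Qed.

Lemma expect_sqdist_point mu q : sphere q ->
  \int[normal3 mu 0]_p sqdist q (vec p) = sqdist q mu.
Proof.
move=> sq.
have o1 : orthomx (1%:M : 'M[R]_3) by rewrite /orthomx trmx1 mulmx1.
rewrite (expect_normal3_std mu 0 (M := pi ^+ 2) o1); last 2 first.
- by apply: measurable_sqdist => //; exact: mvec_vec.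
- by move=> x; exact: sqdist_le.
rewrite /Rintegral; under eq_integral do rewrite scale0r addr0.
by rewrite integral_probability_cst.
Qed.

Lemma expect_sqdist_lt0 mu q : mu != 0 -> sphere q -> q != pr mu ->
  \int[normal3 mu 0]_p sqdist (pr mu) (vec p) <
  \int[normal3 mu 0]_p sqdist q (vec p).
Proof.
move=> mu0 sq qm; have sm := pr_sphere mu0.
rewrite !expect_sqdist_point//.
rewrite [ltLHS](_ : _ = 0); last first.
  by rewrite /sqdist /sdist (sphereE _).1// acos1 expr0n.
rewrite exprn_even_gt0//=; apply/eqP => /= d0.
have cI := dot_sphere_le1 sq sm.
move/eqP : qm; apply; apply/esym/dot_sphere_eq1 => //.
by rewrite -[LHS]acosK ?in_itv//= -/(sdist q (pr mu)) d0 cos0.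
Qed.

Lemma intrinsic_mean_isotropic d (T : measurableType d) (P : probability T R)
  (X : T -> 'rV[R]_3) mu sigma : mu != 0 -> isotropic_normal P X mu sigma ->
  intrinsic_mean P (@pr R \o X) = pr mu.
Proof.
move=> mu0 isoX; have sm := pr_sphere mu0.
have frE q : sphere q -> frechet P (@pr R \o X) q =
    (\int[normal3 mu sigma]_p sqdist q (vec p))%R%:E.
  move=> sq; rewrite /frechet.
  apply: (expect_isotropic (F := sqdist q) (M := pi ^+ 2) isoX).
    by apply: measurable_sqdist => //; exact: mvec_vec.
  by move=> x; exact: sqdist_le.
have lt_fr q : sphere q -> q != pr mu ->
    (frechet P (@pr R \o X) (pr mu) < frechet P (@pr R \o X) q)%E.
  move=> sq qm; rewrite !frE// lte_fin.
  have [s0|s0] := eqVneq sigma 0; first by rewrite s0 expect_sqdist_lt0.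
  exact: expect_sqdist_lt.
apply: xget_unique => [|q [sq qmin]].
  split=> // q sq; have [->//|/(lt_fr _ sq)/ltW//] := eqVneq q (pr mu).
apply/eqP; apply: contraT => /(lt_fr _ sq).
by rewrite ltNge qmin.
Qed.

End mean.

(** * The second moments of the logarithm *)

Section log_moments.
Variable R : realType.
Local Notation T3 := (M3 R).
Local Notation i0 := (inord 0 : 'I_3).
Local Notation i1 := (inord 1 : 'I_3).
Local Notation i2 := (inord 2 : 'I_3).
Local Notation G3 := (normal3 (0 : 'rV[R]_3) 1).
Implicit Types (mu x y q m : 'rV[R]_3) (sigma : R) (A B : 'M[R]_3).

(** The distance from x to the first axis. *)
Definition rad x : R := Num.sqrt (x 0 i1 ^+ 2 + x 0 i2 ^+ 2).

Lemma sqr_rad x : rad x ^+ 2 = x 0 i1 ^+ 2 + x 0 i2 ^+ 2.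
Proof. by rewrite sqr_sqrtr// addr_ge0 ?sqr_ge0. Qed.

Lemma rad_ge0 x : 0 <= rad x. Proof. exact: sqrtr_ge0. Qed.

Lemma dot_rad x : dot x x = x 0 i0 ^+ 2 + rad x ^+ 2.
Proof. by rewrite sqr_rad dotE sum_ord3 -!expr2 addrA. Qed.

Lemma acos_atan (a b : R) : 0 < b ->
  acos (a / Num.sqrt (a ^+ 2 + b ^+ 2)) = pi / 2 - atan (a / b).
Proof.
move=> b0; set u := a / b; have cu : 0 < cos (atan u).
  by rewrite cos_gt0_pihalf// atan_gtNpi2 atan_ltpi2.
have -> : a / Num.sqrt (a ^+ 2 + b ^+ 2) = cos (pi / 2 - atan u).
  rewrite cosB cos_pihalf mul0r add0r sin_pihalf mul1r.
  have -> : sin (atan u) = u * cos (atan u).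
    by rewrite -[X in X * _](atanK u) /tan divfK// gt_eqF.
  rewrite cos_atan /u.
  have -> : a ^+ 2 + b ^+ 2 = b ^+ 2 * (1 + (a / b) ^+ 2).
    by field; rewrite gt_eqF.
  rewrite sqrtrM ?sqr_ge0// sqrtr_sqr gtr0_norm//.
  by rewrite invfM mulrA.
rewrite cosK// in_itv/= subr_ge0 ltW ?atan_ltpi2//= lerBlDr -lerBlDl.
have := atan_gtNpi2 u; set h := pi / 2; set t := atan u => ht.
by rewrite [pi]splitr -/h opprD addrA subrr add0r ltW.
Qed.

Definition log_e1 x := log_map (e1 R) (pr x).

Lemma dot_e1_pr x : dot (e1 R) (pr x) = x 0 i0 / enorm x.
Proof. by rewrite dotC dot_e1 mxE mulrC. Qed.

(** Projecting x to the sphere divides both its distance to the first axis and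
    its residual by the norm of x, so that the norm cancels. *)
Lemma log_e1E x :
  log_e1 x = (acos (dot (e1 R) (pr x)) / rad x) *: (x - x 0 i0 *: e1 R).
Proof.
rewrite /log_e1 (log_mapE (sphere_e1 R) (pr_sphere_or0 x)).
have [->|x0] := eqVneq x 0.
  by rewrite pr0 dot0r !mxE !scale0r subrr !scaler0.
have e0 : 0 < enorm x by rewrite enorm_gt0.
rewrite dot_e1_pr; have -> : 1 - (x 0 i0 / enorm x) ^+ 2 = (rad x / enorm x) ^+ 2.
  rewrite !exprMn exprVn -(mulfV (lt0r_neq0 (exprn_gt0 2 e0))) -mulrBl.
  by congr (_ * _); rewrite sqr_enorm dot_rad addrAC subrr add0r.
rewrite sqrtr_sqr ger0_norm ?divr_ge0 ?rad_ge0 ?(ltW e0)//.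
have -> : pr x - (x 0 i0 / enorm x) *: e1 R = (enorm x)^-1 *: (x - x 0 i0 *: e1 R).
  by rewrite /pr scalerBr scalerA mulrC.
rewrite scalerA; congr (_ *: _).
have [->|r0] := eqVneq (rad x) 0; first by rewrite !(mul0r, invr0, mulr0).
by field; rewrite r0 gt_eqF.
Qed.

Lemma log_e1_fst x : log_e1 x 0 i0 = 0.
Proof. by rewrite log_e1E !mxE !eqxx mulr1 subrr mulr0. Qed.

Lemma dot_log_e1 x : dot (log_e1 x) (log_e1 x) =
  if rad x == 0 then 0 else (pi / 2 - atan (x 0 i0 / rad x)) ^+ 2.
Proof.
rewrite log_e1E dotZ.
have -> : dot (x - x 0 i0 *: e1 R) (x - x 0 i0 *: e1 R) = rad x ^+ 2.
  rewrite -[x 0 i0]dot_e1 (dotC x) dot_residual; last exact: sphere_e1.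
  by rewrite dotC dot_e1 dot_rad addrAC subrr add0r.
case: ifPn => [/eqP->|r0]; first by rewrite expr0n mulr0.
rewrite -expr2 -exprMn divfK// dot_e1_pr.
have rgt0 : 0 < rad x by rewrite lt0r r0 rad_ge0.
by rewrite -(acos_atan _ rgt0) /enorm dot_rad.
Qed.

Lemma dot_log_e1_le x : dot (log_e1 x) (log_e1 x) <= pi ^+ 2.
Proof.
rewrite dot_log_e1; case: ifPn => _; first by rewrite sqr_ge0.
set t := atan _; have := atan_ltpi2 (x 0 i0 / rad x).
have := atan_gtNpi2 (x 0 i0 / rad x); rewrite -/t => t1 t2.
have p0 := pi_gt0 R.
by rewrite ler_pXn2r// ?nnegrE; lra.
Qed.

Lemma norm_log_e1_le x i j : `|log_e1 x 0 i * log_e1 x 0 j| <= pi ^+ 2.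
Proof. exact/norm_coordM_le/dot_log_e1_le. Qed.

Lemma log_e1_orthomx B x : orthomx B -> e1 R *m B = e1 R ->
  log_e1 (x *m B) = log_e1 x *m B.
Proof.
move=> oB eB; rewrite /log_e1 -[in LHS]eB log_map_orthomx//; exact: sphere_e1.
Qed.

Lemma measurable_log_map d (T : measurableType d) q (h : T -> 'rV[R]_3) :
  sphere q -> mvec h -> mvec (fun t => log_map q (pr (h t))).
Proof.
move=> sq mh i; under eq_fun do rewrite (log_mapE sq (pr_sphere_or0 _)).
have mp := mvec_pr mh; have md : measurable_fun setT (fun t => dot q (pr (h t))).
  by apply: measurable_dot => //; exact: mvec_cst.
move: i; apply: mvecZ.
  apply: measurable_funM; first by apply: measurable_acos => // t; exact: dot_pr_le1.
  apply: (measurableT_comp (@measurable_invr R)).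
  apply: (measurableT_comp (@measurable_sqrt R)).
  by apply: measurable_funB => //; exact: measurable_funX.
apply: mvecD => //; under [X in mvec X]eq_fun do rewrite -scaleN1r scalerA.
apply: mvecZ; first exact: measurable_funM.
exact: mvec_cst.
Qed.

(** The point [mu + sigma *: x], with [r] the norm of [mu], in coordinates whose
    first axis is [mu]. *)
Definition shifted (r sigma : R) x := r *: e1 R + sigma *: x.

Definition log_mom (r sigma : R) (i j : 'I_3) : R :=
  \int[G3]_p (log_e1 (shifted r sigma (vec p)) 0 i *
              log_e1 (shifted r sigma (vec p)) 0 j).

Let mlog r sigma : @mvec R _ T3 (fun p => log_e1 (shifted r sigma (vec p))).
Proof.
apply: measurable_log_map; first exact: sphere_e1.
apply: mvecD; first exact: mvec_cst.
by apply: mvecZ => //; exact: mvec_vec.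
Qed.

Let ilog r sigma i j : G3.-integrable setT
  (EFin \o (fun p => log_e1 (shifted r sigma (vec p)) 0 i *
                     log_e1 (shifted r sigma (vec p)) 0 j)).
Proof.
apply: (@bounded_integrable _ _ _ _ _ (pi ^+ 2)) => [|p]; last exact: norm_log_e1_le.
by apply: measurable_funM; exact: mlog.
Qed.

(** An orthogonal map fixing the first axis preserves the standard normal law
    and commutes with [shifted] and with the logarithm. *)
Lemma log_mom_orthomx r sigma B i j : orthomx B -> e1 R *m B = e1 R ->
  log_mom r sigma i j =
  \int[G3]_p ((log_e1 (shifted r sigma (vec p)) *m B) 0 i *
              (log_e1 (shifted r sigma (vec p)) *m B) 0 j).
Proof.
move=> oB eB; rewrite /log_mom.
rewrite (expect_normal3_std 0 1 (M := pi ^+ 2)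
  (F := fun x => log_e1 (shifted r sigma x) 0 i * log_e1 (shifted r sigma x) 0 j) oB).
- apply: eq_Rintegral => p _; rewrite add0r scale1r.
  have -> : shifted r sigma (vec p *m B) = shifted r sigma (vec p) *m B.
    by rewrite /shifted mulmxDl -!scalemxAl eB.
  by rewrite log_e1_orthomx.
- by apply: measurable_funM; exact: mlog.
- by move=> x; exact: norm_log_e1_le.
Qed.

Let eb (i : 'I_3) : 'rV[R]_3 := delta_mx 0 i.

Let i01 : (i0 == i1) = false. Proof. by rewrite -val_eqE/= !inordK. Qed.
Let i02 : (i0 == i2) = false. Proof. by rewrite -val_eqE/= !inordK. Qed.
Let i12 : (i1 == i2) = false. Proof. by rewrite -val_eqE/= !inordK. Qed.

(** By the reflection exchanging the second and third axes. *)
Lemma log_mom_swap r sigma : log_mom r sigma i1 i1 = log_mom r sigma i2 i2.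
Proof.
pose B := householder (eb i1) (eb i2).
have oB : orthomx B by exact: householder_orthomx.
have w2 : dot (eb i1 - eb i2) (eb i1 - eb i2) = 2.
  rewrite !(dotDl, dotDr, dotNl, dotNr) !dot_delta !mxE !eqxx/= i12 eq_sym i12/=.
  by ring.
have Bx x : x *m B = x - (x 0 i1 - x 0 i2) *: (eb i1 - eb i2).
  by rewrite mul_householder w2 divff// mul1r dotDr dotNr !dot_delta.
have eB : e1 R *m B = e1 R.
  by rewrite Bx !mxE !(eq_sym _ i0) i01 i02 andbF subrr scale0r subr0.
rewrite (log_mom_orthomx _ _ _ _ oB eB); apply: eq_Rintegral => p _.
rewrite Bx; set l := log_e1 _.
suff -> : (l - (l 0 i1 - l 0 i2) *: (eb i1 - eb i2)) 0 i1 = l 0 i2 by [].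
by rewrite !mxE !eqxx i12/=; ring.
Qed.

(** By the reflection reversing the third axis, which changes the sign. *)
Lemma log_mom_cross r sigma : log_mom r sigma i1 i2 = 0.
Proof.
pose B := householder (eb i2) (- eb i2).
have oB : orthomx B by exact: householder_orthomx.
have w2 : dot (eb i2 - - eb i2) (eb i2 - - eb i2) = 4.
  rewrite opprK !(dotDl, dotDr) !dot_delta !mxE !eqxx/=; ring.
have Bx x : x *m B = x - (2 * x 0 i2) *: eb i2.
  rewrite mul_householder w2 opprK dotDr !dot_delta; congr (_ - _).
  by rewrite scalerDr -scalerDl; congr (_ *: _); field.
have eB : e1 R *m B = e1 R.
  by rewrite Bx !mxE !(eq_sym _ i0) i02 andbF mulr0 scale0r subr0.
have : log_mom r sigma i1 i2 = - log_mom r sigma i1 i2.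
  rewrite {1}(log_mom_orthomx _ _ _ _ oB eB) -mulN1r.
  rewrite -[RHS](RintegralZl (-1) measurableT (ilog r sigma i1 i2)).
  apply: eq_Rintegral => p _; rewrite Bx !mxE !eqxx i12/=; ring.
by lra.
Qed.

(** The logarithm is orthogonal to the first axis, so its squared norm is the sum
    of two squares of equal mean. *)
Lemma log_mom_half r sigma : log_mom r sigma i1 i1 =
  (\int[G3]_p dot (log_e1 (shifted r sigma (vec p)))
                  (log_e1 (shifted r sigma (vec p)))) / 2.
Proof.
apply: (mulIf (_ : 2 != 0 :> R)) => //; rewrite divfK//.
have -> : log_mom r sigma i1 i1 * 2 = log_mom r sigma i1 i1 + log_mom r sigma i2 i2.
  by rewrite -log_mom_swap; ring.
rewrite -(RintegralD measurableT (ilog r sigma i1 i1) (ilog r sigma i2 i2)).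
by apply: eq_Rintegral => p _; rewrite dotE sum_ord3 log_e1_fst mul0r add0r.
Qed.

(** In coordinates whose first axis is [pr mu] the matrix of second moments is
    diagonal with entries 0, v, v, by [log_e1_fst], [log_mom_swap] and
    [log_mom_cross]. *)
Lemma log_moment_isotropic d (T : measurableType d) (P : probability T R)
  (X : T -> 'rV[R]_3) mu sigma : mu != 0 -> isotropic_normal P X mu sigma ->
  log_moment P (@pr R \o X) (pr mu) =
  log_mom (enorm mu) sigma i1 i1 *: (1%:M - (pr mu)^T *m pr mu).
Proof.
move=> mu0 isoX; set m := pr mu; have sm : sphere m by exact: pr_sphere.
have muE0 : mu = enorm mu *: m := enorm_scale_pr mu.
clearbody m; have [A [oA eA AK]] : exists A, [/\ orthomx A, e1 R *m A = m &
    forall x, x *m A *m A = x].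
  exists (householder (e1 R) m); split.
  - exact: householder_orthomx.
  - exact: householder_e1.
  - exact: householderK.
have logA x : log_map m (pr (x *m A)) = log_e1 x *m A.
  by rewrite -[in LHS]eA log_map_orthomx//; exact: sphere_e1.
apply/matrixP => i j; rewrite mxE.
pose F x := log_map m (pr x) 0 i * log_map m (pr x) 0 j.
have mF : measurable_fun setT (F \o @vec R).
  by apply: measurable_funM; apply: measurable_log_map => //; exact: mvec_vec.
have log_bound x : dot (log_map m (pr x)) (log_map m (pr x)) <= pi ^+ 2.
  by rewrite -(AK x) logA dot_orthomx// dot_log_e1_le.
have FM x : `|F x| <= pi ^+ 2 by exact/norm_coordM_le/log_bound.
rewrite (expect_isotropic isoX mF FM) (expect_normal3_std mu sigma oA mF FM)/=.
have muE p : mu + sigma *: (vec p *m A) = shifted (enorm mu) sigma (vec p) *m A.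
  by rewrite /shifted mulmxDl -!scalemxAl eA -muE0.
pose l p := log_e1 (shifted (enorm mu) sigma (vec p)).
have FE p : F (mu + sigma *: (vec p *m A)) =
    (A i1 i * A i1 j * (l p 0 i1 * l p 0 i1) +
     A i2 i * A i2 j * (l p 0 i2 * l p 0 i2)) +
    (A i1 i * A i2 j + A i2 i * A i1 j) * (l p 0 i1 * l p 0 i2).
  rewrite /F muE logA -/(l p) !mxE !sum_ord3 log_e1_fst. ring.
under eq_Rintegral do rewrite FE.
have iZ c a b : G3.-integrable setT (EFin \o (fun p => c * (l p 0 a * l p 0 b))).
  exact: (integrableZl measurableT c (ilog (enorm mu) sigma a b)).
have iD := integrableD measurableT (iZ (A i1 i * A i1 j) i1 i1)
  (iZ (A i2 i * A i2 j) i2 i2).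
rewrite (RintegralD measurableT iD (iZ _ i1 i2)).
rewrite (RintegralD measurableT (iZ _ i1 i1) (iZ _ i2 i2)).
have Zl c a b : \int[G3]_p (c * (l p 0 a * l p 0 b)) =
    c * log_mom (enorm mu) sigma a b.
  exact: (RintegralZl c measurableT (ilog (enorm mu) sigma a b)).
rewrite !Zl log_mom_cross mulr0 addr0.
rewrite -log_mom_swap -mulrDl mulrC !mxE; congr (_ * _).
have : (A^T *m A) i j = (1%:M : 'M[R]_3) i j by rewrite mulmx1C.
rewrite !mxE sum_ord3 !mxE => <-; rewrite big_ord1 !mxE.
have mi k : m 0 k = A i0 k.
  by rewrite -eA mxE sum_ord3 !mxE !eqxx !(eq_sym _ i0) i01 i02/=; ring.
by rewrite !mi; ring.
Qed.

End log_moments.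

(** * The uniform direction *)

Section line.
Variable R : realType.
Local Notation lam := (@lebesgue_measure R).
Local Open Scope ereal_scope.

Lemma lebesgue_measure_scale (s : R) (A : set R) : (0 < s)%R -> measurable A ->
  lam ((fun x => s * x)%R @^-1` A) = (s^-1)%:E * lam A.
Proof.
move=> s0 mA; pose T : measurableTypeR R -> measurableTypeR R := fun x => (s * x)%R.
have mT : measurable_fun setT T by exact: measurable_funM.
pose nn : {nonneg R} := NngNum (ltW s0).
pose M0 : {measure set (measurableTypeR R) -> \bar R} :=
  mscale nn (pushforward lam T).
pose M := M0 mT.
have ME (B : set (measurableTypeR R)) : M B = s%:E * lam (T @^-1` B) by [].
have lamM : forall B, measurable B -> lam B = M B.
  apply: lebesgue_measure_unique => _ [[b c]] _ <-; rewrite ME.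
  rewrite (_ : T @^-1` _ = `](b / s)%R, (c / s)%R]%classic); last first.
    apply/seteqP; split => x /=;
      by rewrite !in_itv/= /T ltr_pdivrMr// ler_pdivlMr// mulrC.
  rewrite !lebesgue_measure_itv/= !lte_fin ltr_pM2r ?invr_gt0//.
  case: ifPn => _; last by rewrite mule0.
  by rewrite -!EFinB -EFinM -mulrBl mulrC divfK// gt_eqF.
by rewrite (lamM _ mA) ME muleA -EFinM mulVf ?mul1e// gt_eqF.
Qed.

Lemma integral_scale (s : R) (f : R -> \bar R) : (0 < s)%R ->
  measurable_fun setT f -> (forall x, 0 <= f x) ->
  \int[lam]_x f x = s%:E * \int[lam]_x f (s * x)%R.
Proof.
move=> s0 mf f0.
pose T : measurableTypeR R -> measurableTypeR R := fun x => (s * x)%R.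
have mT : measurable_fun setT T by exact: measurable_funM.
pose nn : {nonneg R} := NngNum (ltW s0).
pose M0 : {measure set (measurableTypeR R) -> \bar R} :=
  mscale nn (pushforward lam T).
pose M := M0 mT.
have lamM B : measurable B -> lam B = M B.
  move=> mB; rewrite -[RHS]/(s%:E * lam (T @^-1` B)).
  rewrite [X in _ * X](lebesgue_measure_scale s0 mB) muleA -EFinM.
  by rewrite mulfV ?mul1e// gt_eqF.
rewrite (eq_measure_integral M); last by move=> A mA _; exact: lamM.
rewrite ge0_integral_mscale//; congr (_ * _).
by rewrite ge0_integral_pushforward.
Qed.

(** The half-line version of the fundamental theorem applies on the right of 0,
    and, after x |-> - x, on the left. *)
Lemma integral_line_FTC (f F : R -> R) (a b : R) : (forall x, (0 <= f x)%R) ->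
  continuous f -> (forall x : R, is_derive x (1%R : R) F (f x)) ->
  F x @[x --> -oo%R] --> a -> F x @[x --> +oo%R] --> b ->
  \int[lam]_x (f x)%:E = (b - a)%:E.
Proof.
move=> f0 cf dF Fa Fb.
have mf : measurable_fun setT (EFin \o f).
  by apply/measurable_EFinP; exact: continuous_measurable_fun.
have cF : continuous F.
  by move=> x; apply/differentiable_continuous/derivable1_diffP; have [] := dF x.
have right : \int[lam]_(x in `[0%R, +oo[) (f x)%:E = b%:E - (F 0%R)%:E.
  apply: ge0_continuous_FTC2y => //.
  - exact: continuous_subspaceT.
  - exact/cvg_at_right_filter/cF.
  - by move=> x _; rewrite derive1E; have [_ ->] := dF x.
pose FN x : R := (- F (- x))%R.
have dFN (x : R) : is_derive x (1%R : R) FN (f (- x))%R.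
  have d1 : is_derive x (1%R : R) (F \o -%R) (f (- x) * -1)%R.
    by apply: is_derive1_comp; exact: dF.
  have := is_deriveN d1; rewrite mulrN1 opprK.
  exact.
have cFN : continuous FN.
  by move=> x; apply/differentiable_continuous/derivable1_diffP; have [] := dFN x.
have cfN : continuous (fun x => f (- x))%R.
  by move=> x; apply: continuous_comp; [exact: opp_continuous|exact: cf].
have left : \int[lam]_(x in `[0%R, +oo[) (f (- x))%:E = (- a)%:E - (FN 0%R)%:E.
  apply: ge0_continuous_FTC2y => //.
  - exact: continuous_subspaceT.
  - by apply: cvgN; move/cvgNy_compNP : Fa.
  - exact/cvg_at_right_filter/cFN.
  - by move=> x _; rewrite derive1E; have [_ ->] := dFN x.
rewrite -(setUv `]-oo, 0%R]%classic) ge0_integral_setU//=; last 4 first.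
- exact: measurableC.
- by rewrite setUv.
- by move=> x _; rewrite lee_fin.
- exact/disj_setPCl.
have mfN : measurable_fun setT (fun x : R => (f (- x))%:E).
  by apply/measurable_EFinP; exact: continuous_measurable_fun.
have -> : \int[lam]_(x in `]-oo, 0%R]) (f x)%:E = (F 0)%:E - a%:E.
  transitivity (\int[lam]_(x in `]-oo, 0%R]) (f (- - x))%:E).
    by apply: eq_integral => x _; rewrite opprK.
  rewrite -(ge0_integration_by_substitution0 mfN); last by move=> x; rewrite lee_fin.
  by rewrite left /FN oppr0 -!EFinB opprK addrC.
rewrite setCitvl integral_itv_obnd_cbnd; last exact: measurable_funTS.
by rewrite right -!EFinB -EFinD; congr (_%:E); ring.
Qed.

End line.

Section angle.
Variable R : realType.
Local Notation lam := (@lebesgue_measure R).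

Lemma sqr_cos_atan (u : R) : cos (atan u) ^+ 2 = (1 + u ^+ 2)^-1.
Proof. by rewrite cos_atan exprVn sqr_sqrtr// addr_ge0 ?sqr_ge0. Qed.

Lemma cos_atan_gt0 (u : R) : 0 < cos (atan u).
Proof. by rewrite cos_gt0_pihalf// atan_gtNpi2 atan_ltpi2. Qed.

Lemma cvgNy_atan : (@atan R) x @[x --> -oo] --> - (pi / 2).
Proof.
apply/cvgNy_compNP; rewrite (_ : atan \o -%R = (fun x => - atan x)).
  by apply: cvgN; exact: cvgy_atan.
by apply/funext => x /=; rewrite atanN.
Qed.

Lemma continuous_cos_atan : continuous (fun u : R => cos (atan u)).
Proof.
by move=> u; apply: continuous_comp; [exact: continuous_atan|exact: continuous_cos].
Qed.

Lemma continuous_cos3_atan : continuous (fun u : R => cos (atan u) ^+ 3).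
Proof.
move=> u; apply: (@continuous_comp _ _ _ (fun u => cos (atan u)) (fun x => x ^+ 3)).
  exact: continuous_cos_atan.
exact: exprn_continuous.
Qed.

Lemma integral_cos3_atan : (\int[lam]_u (cos (atan u) ^+ 3)%:E = 2%:E)%E.
Proof.
have f0 (u : R) : 0 <= cos (atan u) ^+ 3 by rewrite exprn_ge0// ltW// cos_atan_gt0.
have dF (u : R) : is_derive u (1 : R) (fun u => sin (atan u)) (cos (atan u) ^+ 3).
  have := is_derive1_comp (is_derive_sin (atan u)) (is_derive1_atan u).
  by rewrite -sqr_cos_atan -exprS.
have Fa : sin (atan u) @[u --> -oo] --> (-1 : R).
  rewrite -sin_pihalf -sinN.
  by apply: continuous_cvg; [exact: continuous_sin|exact: cvgNy_atan].
have Fb : sin (atan u) @[u --> +oo] --> (1 : R).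
  rewrite -[X in _ --> X]sin_pihalf.
  by apply: continuous_cvg; [exact: continuous_sin|exact: cvgy_atan].
by rewrite (integral_line_FTC f0 continuous_cos3_atan dF Fa Fb) opprK.
Qed.

(** An antiderivative of - t^2 sin t. *)
Let Phi (t : R) : R := t ^+ 2 * cos t - 2 * (t * sin t) - 2 * cos t.

Let dPhi (t : R) : is_derive t 1 Phi (- (t ^+ 2 * sin t)).
Proof.
rewrite (_ : Phi = (id ^+ 2 * (@cos R) - 2 *: (id * (@sin R)) - 2 *: (@cos R)))//.
apply: is_derive_eq; rewrite /GRing.scale/= !fctE/=; ring.
Qed.

Let cPhi : continuous Phi.
Proof.
by move=> x; apply/differentiable_continuous/derivable1_diffP; have [] := dPhi x.
Qed.

(** With t = pi / 2 - atan u, so that dt = - cos (atan u)^2 du and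
    sin t = cos (atan u), this is the integral of t^2 sin t over [0, pi]. *)
Lemma integral_sqr_angle :
  (\int[lam]_u ((pi / 2 - atan u) ^+ 2 * cos (atan u) ^+ 3)%:E = (pi ^+ 2 - 4)%:E)%E.
Proof.
pose g u : R := (pi / 2 - atan u) ^+ 2 * cos (atan u) ^+ 3.
have g0 u : 0 <= g u.
  by rewrite mulr_ge0 ?sqr_ge0// exprn_ge0// ltW// cos_atan_gt0.
have cg : continuous g.
  move=> u; apply: cvgM; last exact: continuous_cos3_atan.
  apply: (@continuous_comp _ _ _ (fun u => pi / 2 - atan u) (fun x => x ^+ 2)).
    by apply: cvgB; [exact: cvg_cst|exact: continuous_atan].
  exact: exprn_continuous.
have dF (u : R) : is_derive u (1 : R) (fun u => Phi (pi / 2 - atan u)) (g u).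
  have d1 : is_derive u (1 : R) (fun u => pi / 2 - atan u) (- (1 + u ^+ 2)^-1).
    have := is_deriveB (is_derive_cst (pi / 2 : R) u 1) (is_derive1_atan u).
    by rewrite sub0r.
  have := @is_derive1_comp R Phi (fun u => pi / 2 - atan u) u _ _
    (dPhi (pi / 2 - atan u)) d1.
  rewrite -sqr_cos_atan sinB sin_pihalf cos_pihalf mul1r mul0r subr0.
  by rewrite mulrNN -mulrA -exprS.
have Fa : Phi (pi / 2 - atan u) @[u --> -oo] --> Phi pi.
  apply: continuous_cvg; first exact: cPhi.
  rewrite [X in _ --> X](_ : pi = pi / 2 - - (pi / 2)); last by rewrite opprK -splitr.
  by apply: cvgB; [exact: cvg_cst|exact: cvgNy_atan].
have Fb : Phi (pi / 2 - atan u) @[u --> +oo] --> Phi 0.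
  apply: continuous_cvg; first exact: cPhi.
  rewrite [X in _ --> X](_ : 0 = pi / 2 - pi / 2); last by rewrite subrr.
  by apply: cvgB; [exact: cvg_cst|exact: cvgy_atan].
rewrite (integral_line_FTC g0 cg dF Fa Fb).
by congr (_%:E); rewrite /Phi cos0 sin0 cospi sinpi; ring.
Qed.

End angle.

Section ratio.
Variable R : realType.
Local Notation R1 := (measurableTypeR R).
Local Notation T2 := (R1 * R1)%type.
Local Notation T3 := (M3 R).
Local Notation lam := (@lebesgue_measure R).
Local Notation leb2 := (sfprod lam lam).
Local Notation G3 := (normal3 (0 : 'rV[R]_3) 1).

Definition rad2 (w : R * R) : R := Num.sqrt (w.1 ^+ 2 + w.2 ^+ 2).

Lemma rad2_ge0 w : 0 <= rad2 w. Proof. exact: sqrtr_ge0. Qed.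

Lemma sqr_rad2 w : rad2 w ^+ 2 = w.1 ^+ 2 + w.2 ^+ 2.
Proof. by rewrite sqr_sqrtr// addr_ge0 ?sqr_ge0. Qed.

Lemma rad2Z (s : R) w : 0 <= s -> rad2 (s * w.1, s * w.2) = s * rad2 w.
Proof.
move=> s0; rewrite /rad2/= !exprMn -mulrDr sqrtrM ?sqr_ge0// sqrtr_sqr.
by rewrite ger0_norm.
Qed.

Lemma measurable_rad2 : measurable_fun (setT : set T2) rad2.
Proof.
apply: (measurableT_comp (@measurable_sqrt R)).
by apply: measurable_funD; apply: measurable_funX.
Qed.

(** The Jacobian [rad2 w] of x = u * rad2 w times the standard normal density at
    the point (w, u * rad2 w). *)
Let ray (w : R * R) (u : R) : R :=
  normal_peak 1 ^+ 3 * rad2 w * expR (- (1 + u ^+ 2) * rad2 w ^+ 2 / 2).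

Let ray_ge0 w u : 0 <= ray w u.
Proof. by rewrite /ray !mulr_ge0 ?expR_ge0 ?rad2_ge0 ?exprn_ge0 ?normal_peak_ge0. Qed.

Let measurable_ray d (T : measurableType d) (f : T -> T2) (g : T -> R) :
  measurable_fun setT f -> measurable_fun setT g ->
  measurable_fun setT (fun t => ray (f t) (g t)).
Proof.
move=> mf mg; have mr := measurableT_comp measurable_rad2 mf.
apply: measurable_funM; first exact: measurable_funM.
apply: measurableT_comp => //; apply: measurable_funM => //.
apply: measurable_funM; last exact: measurable_funX.
by apply/measurable_funN; apply: measurable_funD => //; exact: measurable_funX.
Qed.

Local Open Scope ereal_scope.

(** Fubini and the scaling of each coordinate. *)
Lemma integral_leb2_scale (s : R) (f : R * R -> \bar R) : (0 < s)%R ->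
  measurable_fun (setT : set T2) f -> (forall w, 0 <= f w) ->
  \int[leb2]_w f w = (s ^+ 2)%:E * \int[leb2]_w f (s * w.1, s * w.2)%R.
Proof.
move=> s0 mf f0.
have ms : measurable_fun setT (fun x : R1 => s * x)%R by exact: measurable_funM.
pose fy (w : T2) := f (w.1, s * w.2)%R.
have mfy : measurable_fun setT fy.
  apply: (measurableT_comp mf); apply: measurable_fun_pair => //.
  by apply: (measurableT_comp ms); exact: measurable_snd.
have fy0 w : 0 <= fy w by exact: f0.
have mfs : measurable_fun setT (fun w : T2 => f (s * w.1, s * w.2)%R).
  apply: (measurableT_comp mf); apply: measurable_fun_pair.
    by apply: (measurableT_comp ms); exact: measurable_fst.
  by apply: (measurableT_comp ms); exact: measurable_snd.
rewrite [LHS](fubini_tonelli1 _ mf f0).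
rewrite [X in _ * X](fubini_tonelli1 _ mfs (fun w => f0 _)).
transitivity (\int[lam]_x (s%:E * \int[lam]_y fy (x, y))).
  apply: eq_integral => x _; apply: integral_scale => //.
  by apply: (measurableT_comp mf); exact: measurable_fun_pair.
have mF : measurable_fun setT (fun x => \int[lam]_y fy (x, y)).
  exact: (measurable_fun_fubini_tonelli_F (m2 := lam) _ mfy fy0).
have F0 x : 0 <= \int[lam]_y fy (x, y) by apply: integral_ge0.
have sge0 : 0 <= s%:E by rewrite lee_fin ltW.
rewrite (ge0_integralZl lam measurableT mF (fun x _ => F0 x) sge0).
rewrite (integral_scale s0 mF F0) muleA -EFinM -expr2.
by [].
Qed.

(** The normalizing constant of the density of the ratio in [integral_ratio]; its
    value 1 / 2 is found in [ray_mass_half] from the total mass. *)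
Definition ray_mass : \bar R := \int[leb2]_w (ray w 0)%:E.

Lemma ray_mass_ge0 : 0 <= ray_mass.
Proof. by apply: integral_ge0 => w _; rewrite lee_fin. Qed.

(** Scaling w by cos (atan u) turns the exponent at slope u into the exponent at
    slope 0; the scaling of the plane contributes two factors cos (atan u), the
    Jacobian [rad2] a third one. *)
Lemma integral_ray (u : R) :
  \int[leb2]_w (ray w u)%:E = (cos (atan u) ^+ 3)%:E * ray_mass.
Proof.
set c := cos (atan u); have c0 : (0 < c)%R by exact: cos_atan_gt0.
have c2 : ((1 + u ^+ 2) * c ^+ 2 = 1)%R.
  by rewrite /c sqr_cos_atan mulfV// gt_eqF// ltr_wpDr// sqr_ge0.
have mray v : measurable_fun (setT : set T2) (fun w => (ray w v)%:E).
  by apply/measurable_EFinP; apply: measurable_ray => //; exact: measurable_id.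
rewrite (integral_leb2_scale c0 (mray u)); last by move=> w; rewrite lee_fin.
transitivity ((c ^+ 2)%:E * \int[leb2]_w (c%:E * (ray w 0)%:E)).
  congr (_ * _); apply: eq_integral => w _; rewrite -EFinM; congr (_%:E).
  rewrite /ray rad2Z ?ltW// expr0n addr0 exprMn.
  have -> : (- (1 + u ^+ 2) * (c ^+ 2 * rad2 w ^+ 2) / 2 = - 1 * rad2 w ^+ 2 / 2)%R.
    transitivity (- ((1 + u ^+ 2) * c ^+ 2) * rad2 w ^+ 2 / 2)%R; first by ring.
    by rewrite c2.
  by ring.
rewrite ge0_integralZl//.
- by rewrite muleA -EFinM -exprSr.
- by move=> w _; rewrite lee_fin.
- by rewrite lee_fin ltW.
Qed.

(** The ratio of one coordinate to the norm of the other two has a density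
    proportional to cos (atan u)^3: substitute x = u * rad2 w for the third
    coordinate and integrate in w first.  The factor [rad2 / rad2] is the
    indicator of the points off the third axis. *)
Lemma integral_ratio (h : R -> R) : measurable_fun setT h ->
  (forall u, 0 <= h u)%R ->
  \int[G3]_p ((rad2 p.1 / rad2 p.1 * h (p.2 / rad2 p.1))%:E) =
  (\int[lam]_u (h u * cos (atan u) ^+ 3)%:E) * ray_mass.
Proof.
move=> mh h0.
pose r (x : 'rV[R]_3) := rad2 (x 0%R (inord 0), x 0%R (inord 1)).
pose H (x : 'rV[R]_3) : R := (r x / r x * h (x 0 (inord 2) / r x))%R.
have mc (i : 'I_3) : measurable_fun setT (fun p : T3 => (vec p 0 i)%R) := @mvec_vec R i.
have mr : measurable_fun setT (fun p : T3 => r (vec p)).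
  apply: (measurableT_comp measurable_rad2).
  by apply: measurable_fun_pair; exact: mc.
have mrV : measurable_fun setT (fun p : T3 => (r (vec p))^-1)%R.
  exact: (measurableT_comp (@measurable_invr R)).
have mH : measurable_fun setT ((EFin \o H) \o @vec R).
  apply/measurable_EFinP; apply: measurable_funM; first exact: measurable_funM.
  apply: (measurableT_comp mh); apply: measurable_funM => //; exact: mc.
have H0 x : 0 <= (EFin \o H) x.
  by rewrite lee_fin mulr_ge0// divr_ge0// rad2_ge0.
have rE (p : T3) : r (vec p) = rad2 p.1.
  by rewrite /r !mxE !inordK//=; case: p => -[].
transitivity (\int[G3]_p (EFin \o H) (vec p)).
  by apply: eq_integral => p _; rewrite /= /H rE mxE inordK.
rewrite (integral_normal3 0 (oner_neq0 R) mH H0).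
pose k (p : T3) := (rad2 p.1 / rad2 p.1 * h (p.2 / rad2 p.1) *
  (normal_peak 1 ^+ 3 * expR (- (rad2 p.1 ^+ 2 + p.2 ^+ 2) / 2)))%R.
have kE (p : T3) : (H (vec p) * normal3_pdf 1 (vec p - 0) = k p)%R.
  rewrite subr0 /H /k rE mxE inordK// /normal3_pdf expr1n.
  by rewrite sqr_rad2 dotE sum_ord3 !mxE !inordK// -!expr2; case: p => -[].
have mr1 : measurable_fun setT (fun p : T3 => rad2 p.1).
  by apply: (measurableT_comp measurable_rad2); exact: measurable_fst.
have mr1V : measurable_fun setT (fun p : T3 => (rad2 p.1)^-1)%R.
  exact: (measurableT_comp (@measurable_invr R)).
have mk : measurable_fun setT (fun p => (k p)%:E).
  apply/measurable_EFinP; apply: measurable_funM.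
    apply: measurable_funM; first exact: measurable_funM.
    by apply: (measurableT_comp mh); exact: measurable_funM.
  apply: measurable_funM => //; apply: measurableT_comp => //.
  apply: measurable_funM => //; apply/measurable_funN; apply: measurable_funD.
    exact: measurable_funX.
  by apply: measurable_funX; exact: measurable_snd.
have k0 p : 0 <= (k p)%:E.
  rewrite lee_fin /k; apply: mulr_ge0.
    by rewrite mulr_ge0// divr_ge0// rad2_ge0.
  by rewrite mulr_ge0 ?expR_ge0// exprn_ge0// normal_peak_ge0.
transitivity (\int[leb3 R]_p (k p)%:E).
  by apply: eq_integral => p _; rewrite -kE EFinM.
rewrite leb3.unlock (fubini_tonelli1 _ mk k0).
pose Z (z : T2 * R1) := (h z.2)%:E * (ray z.1 z.2)%:E.
have mZ : measurable_fun setT Z.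
  apply: emeasurable_funM; apply/measurable_EFinP.
    by apply: (measurableT_comp mh); exact: measurable_snd.
  by apply: measurable_ray; [exact: measurable_fst|exact: measurable_snd].
have Z0 z : 0 <= Z z by rewrite mule_ge0// lee_fin.
transitivity (\int[leb2]_w \int[lam]_u Z (w, u)).
  apply: eq_integral => w _; rewrite /fubini_F.
  have mkw : measurable_fun (setT : set R1) (fun x => (k (w, x))%:E).
    by apply: (measurableT_comp mk); exact: measurable_fun_pair.
  have [r0|r0] := eqVneq (rad2 w) 0%R.
    rewrite integral0_eq; last by move=> x _; rewrite /k/= r0 !mul0r.
    by rewrite integral0_eq// => u _; rewrite /Z/= /ray r0 mulr0 mul0r mule0.
  have rgt0 : (0 < rad2 w)%R by rewrite lt0r r0 rad2_ge0.
  rewrite (integral_scale rgt0 mkw); last by move=> x; exact: k0.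
  have mkr : measurable_fun (setT : set R1) (fun u => (k (w, rad2 w * u)%R)%:E).
    by apply: (measurableT_comp mkw); exact: measurable_funM.
  have rge0 : 0 <= (rad2 w)%:E by rewrite lee_fin ltW.
  rewrite -(ge0_integralZl lam measurableT mkr (fun u _ => k0 _) rge0).
  apply: eq_integral => u _; rewrite /Z/= -!EFinM; congr (_%:E).
  rewrite /k/= /ray divff// mul1r.
  have -> : (rad2 w * u / rad2 w = u)%R by rewrite mulrAC divff// mul1r.
  have -> : (- (rad2 w ^+ 2 + (rad2 w * u) ^+ 2) / 2 =
      - (1 + u ^+ 2) * rad2 w ^+ 2 / 2)%R by ring.
  by ring.
rewrite (fubini_tonelli _ mZ Z0).
have mh3 : measurable_fun setT (fun u : R1 => (h u * cos (atan u) ^+ 3)%:E).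
  apply/measurable_EFinP; apply: measurable_funM => //.
  by apply: continuous_measurable_fun; exact: continuous_cos3_atan.
have h30 u : 0 <= (h u * cos (atan u) ^+ 3)%:E.
  by rewrite lee_fin mulr_ge0// exprn_ge0// ltW// cos_atan_gt0.
rewrite -(ge0_integralZr lam measurableT mh3 (fun u _ => h30 u) ray_mass_ge0).
apply: eq_integral => u _; rewrite /Z/= EFinM -muleA -integral_ray.
have mru : measurable_fun (setT : set T2) (fun w => (ray w u)%:E).
  by apply/measurable_EFinP; apply: measurable_ray => //; exact: measurable_id.
have ru0 w : 0 <= (ray w u)%:E by rewrite lee_fin.
have hu0 : 0 <= (h u)%:E by rewrite lee_fin.
exact: (ge0_integralZl leb2 measurableT mru (fun w _ => ru0 w) hu0).
Qed.
End ratio.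

(** * The mean square angle *)

Section angle_moment.
Variable R : realType.
Local Notation R1 := (measurableTypeR R).
Local Notation T3 := (M3 R).
Local Notation G3 := (normal3 (0 : 'rV[R]_3) 1).
Local Notation i0 := (inord 0 : 'I_3).
Local Notation i1 := (inord 1 : 'I_3).
Local Notation i2 := (inord 2 : 'I_3).

(** Apply [integral_ratio] to the constant 1: the total mass is 1, and the
    integral of cos (atan u)^3 is 2. *)
Lemma ray_mass_half : ray_mass R = (1 / 2)%:E.
Proof.
pose Z := [set p : T3 | rad2 p.1 = 0].
have mr : measurable_fun setT (fun p : T3 => rad2 p.1).
  by apply: (measurableT_comp (@measurable_rad2 R)); exact: measurable_fst.
have mZ : measurable Z.
  by have := mr measurableT _ (measurable_set1 0); rewrite setTI.
have Z0 : G3 Z = 0%E.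
  have mn : measurable [set p : T3 | p.1.1 = 0].
    have mf : measurable_fun setT (fun p : T3 => p.1.1).
      by apply: (measurableT_comp (@measurable_fst _ _ R1 R1)); exact: measurable_fst.
    by have := mf measurableT _ (measurable_set1 0); rewrite setTI.
  apply/eqP; rewrite eq_le measure_ge0 andbT -[leRHS](@normal3_fst_null R 0).
  apply: le_measure; rewrite ?inE// => p; rewrite /Z /= => r0.
  have : rad2 p.1 ^+ 2 == 0 by rewrite r0 expr0n.
  by rewrite sqr_rad2 paddr_eq0 ?sqr_ge0// sqrf_eq0 => /andP[/eqP].
have := @integral_ratio R (cst 1) (measurable_cst _) (fun=> ler01).
under [X in _ = (X * _)%E -> _]eq_integral do rewrite /= mul1r.
rewrite integral_cos3_atan.
have -> : (\int[G3]_p (rad2 p.1 / rad2 p.1 * cst 1 (p.2 / rad2 p.1))%:E)%E = 1%E.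
  transitivity (\int[G3]_p (\1_(~` Z) p)%:E)%E.
    apply: eq_integral => p _; congr (_%:E); rewrite mulr1 indicE in_setC.
    have [r0|r0] := eqVneq (rad2 p.1) 0; first by rewrite mem_set// r0 mul0r.
    by rewrite memNset ?divff// => r0'; move/eqP: r0.
  rewrite integral_indic// ?setIT; last exact: measurableC.
  by rewrite [LHS]probability_setC// [X in (_ - X)%E]Z0 sube0.
have := ray_mass_ge0 R; case: (ray_mass R) => [m|//|//] _.
  by rewrite -EFinM => -[] m2; congr (_%:E); lra.
by rewrite gt0_muley// lte_fin.
Qed.

(** The squared angle between the first axis and y + x e_1, off this axis; the
    factor [rad y / rad y] is 0 on the axis and 1 elsewhere. *)
Definition sq_angle (x : R) (y : 'rV[R]_3) : R :=
  rad y / rad y * (pi / 2 - atan ((y 0 i0 + x) / rad y)) ^+ 2.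

Lemma measurable_sq_angle d (T : measurableType d) (x : R) (h : T -> 'rV[R]_3) :
  mvec h -> measurable_fun setT (fun t => sq_angle x (h t)).
Proof.
move=> mh; have mr : measurable_fun setT (fun t => rad (h t)).
  apply: (measurableT_comp (@measurable_sqrt R)).
  by apply: measurable_funD; apply: measurable_funX; exact: mh.
have mrV : measurable_fun setT (fun t => (rad (h t))^-1).
  exact: (measurableT_comp (@measurable_invr R)).
apply: measurable_funM; first exact: measurable_funM.
apply: measurable_funX; apply: measurable_funB => //.
apply: (@measurableT_comp _ _ _ _ _ _ (@atan R)).
  by apply: continuous_measurable_fun => u; exact: continuous_atan.
apply: measurable_funM => //; apply: measurable_funD => //; exact: mh.
Qed.

Lemma half_sub_atan_gt0 (u : R) : 0 < pi / 2 - atan u.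
Proof. by rewrite subr_gt0 atan_ltpi2. Qed.

Lemma sq_angle_ge0 x y : 0 <= sq_angle x y.
Proof. by rewrite mulr_ge0 ?sqr_ge0// divr_ge0// rad_ge0. Qed.

Lemma sq_angle_le x y : `|sq_angle x y| <= pi ^+ 2.
Proof.
rewrite ger0_norm ?sq_angle_ge0// /sq_angle; have [->|r0] := eqVneq (rad y) 0.
  by rewrite !mul0r sqr_ge0.
rewrite divff// mul1r; set u := (_ + x) / _.
have := half_sub_atan_gt0 u; have := atan_gtNpi2 u; set t := atan u => t1 t2.
by have p0 := pi_gt0 R; rewrite ler_pXn2r// ?nnegrE; lra.
Qed.

Lemma sq_angle_lt x x' y : x < x' -> rad y != 0 -> sq_angle x' y < sq_angle x y.
Proof.
move=> xx' r0; rewrite /sq_angle divff// !mul1r.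
have r1 : 0 < rad y by rewrite lt0r r0 rad_ge0.
rewrite ltr_pXn2r// ?nnegrE ?ltW ?half_sub_atan_gt0// ltrD2l ltrN2.
by apply: lt_atan; rewrite ltr_pM2r ?invr_gt0// ltrD2l.
Qed.

(** The mean square angle between m and m + s G, for x = 1 / s. *)
Definition msq_angle (x : R) : R := \int[G3]_p sq_angle x (vec p).

Let iang x : G3.-integrable setT (EFin \o (fun p => sq_angle x (vec p))).
Proof.
apply: (@bounded_integrable _ _ _ _ _ (pi ^+ 2)) => [|p]; last exact: sq_angle_le.
by apply: measurable_sq_angle; exact: mvec_vec.
Qed.

Lemma msq_angle_ge0 x : 0 <= msq_angle x.
Proof. by apply: Rintegral_ge0 => p _; exact: sq_angle_ge0. Qed.

(** The integrand is strictly decreasing in x off the first axis, a null set. *)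
Lemma msq_angle_lt x x' : x < x' -> msq_angle x' < msq_angle x.
Proof.
move=> xx'; rewrite -subr_gt0 /msq_angle -(RintegralB measurableT (iang x) (iang x')).
have hE p : (sq_angle x (vec p) - sq_angle x' (vec p) = 0) <-> rad (vec p) = 0.
  split; last by rewrite /sq_angle => ->; rewrite !mul0r subrr.
  move=> /eqP; rewrite subr_eq0 => /eqP aE; apply/eqP; apply: contraT.
  by move=> /(sq_angle_lt xx'); rewrite aE ltxx.
have mh : measurable_fun setT (fun p : T3 => sq_angle x (vec p) - sq_angle x' (vec p)).
  by apply: measurable_funB; apply: measurable_sq_angle; exact: mvec_vec.
have mZ : measurable [set p : T3 | sq_angle x (vec p) - sq_angle x' (vec p) = 0].
  by have := mh measurableT _ (measurable_set1 0); rewrite setTI.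
apply: Rintegral_gt0 => //.
- exact: (integrableB measurableT (iang x) (iang x')).
- move=> p; rewrite subr_ge0; have [r0|r0] := eqVneq (rad (vec p)) 0.
    by rewrite /sq_angle r0 !mul0r.
  by rewrite ltW// sq_angle_lt.
- have e2 : delta_mx 0 i1 != 0 :> 'rV[R]_3.
    by apply/eqP => /matrixP/(_ 0 i1)/eqP; rewrite !mxE !eqxx oner_eq0.
  apply/eqP; rewrite eq_le measure_ge0 andbT.
  rewrite -[leRHS](normal3_hyperplane 0 (oner_neq0 R) e2).
  apply: le_measure; rewrite ?inE//.
    have md : measurable_fun setT (fun p : T3 => dot (vec p) (delta_mx 0 i1)).
      by apply: measurable_dot; [exact: mvec_vec|exact: mvec_cst].
    by have := md measurableT _ (measurable_set1 0); rewrite setTI.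
  move=> p /= /hE r0; have : rad (vec p) ^+ 2 == 0 by rewrite r0 expr0n.
  rewrite sqr_rad paddr_eq0 ?sqr_ge0// sqrf_eq0 => /andP[/eqP v1 _].
  by rewrite dot_delta.
Qed.

(** The reflection exchanging the first and third axes brings the angle into the
    form of [integral_ratio]. *)
Lemma msq_angle0 : msq_angle 0 = (pi ^+ 2 - 4) / 2.
Proof.
pose h (u : R) : R := (pi / 2 - atan u) ^+ 2.
pose F (x : 'rV[R]_3) : \bar R := (sq_angle 0 x)%:E.
have mF : measurable_fun setT (F \o @vec R).
  by apply/measurable_EFinP; apply: measurable_sq_angle; exact: mvec_vec.
have F0 x : (0 <= F x)%E by rewrite lee_fin sq_angle_ge0.
pose e i : 'rV[R]_3 := delta_mx 0 i.
pose B := householder (e i0) (e i2); have oB : orthomx B by exact: householder_orthomx.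
have i01 : (i0 == i1) = false by rewrite -val_eqE/= !inordK.
have i02 : (i0 == i2) = false by rewrite -val_eqE/= !inordK.
have i12 : (i1 == i2) = false by rewrite -val_eqE/= !inordK.
have w2 : dot (e i0 - e i2) (e i0 - e i2) = 2.
  by rewrite !(dotDl, dotDr, dotNl, dotNr) !dot_delta !mxE !eqxx/= i02 eq_sym i02/=; ring.
have Bx x : x *m B = x - (x 0 i0 - x 0 i2) *: (e i0 - e i2).
  by rewrite mul_householder w2 divff// mul1r dotDr dotNr !dot_delta.
have FB p : F (0 + 1 *: (vec p *m B)) =
    (rad2 p.1 / rad2 p.1 * h (p.2 / rad2 p.1))%:E.
  rewrite add0r scale1r /F /sq_angle /h addr0.
  have -> : rad (vec p *m B) = rad2 p.1.
    rewrite /rad Bx !mxE !inordK//= !eqxx i12 !(eq_sym _ i0) i01 i02/= ?inordK//.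
    rewrite /rad2; congr Num.sqrt; ring.
  rewrite (_ : (vec p *m B) 0 i0 = p.2)//.
  by rewrite Bx !mxE !inordK//= !eqxx i02/=; ring.
rewrite /msq_angle /Rintegral -/(F _).
have -> : (\int[G3]_p (sq_angle 0 (vec p))%:E)%E = ((pi ^+ 2 - 4) * (1 / 2))%:E.
  rewrite -[LHS]/(\int[G3]_p F (vec p))%E (integral_normal3_std 0 1 oB mF F0).
  under eq_integral do rewrite FB.
  rewrite (@integral_ratio _ h); last by move=> u; exact: sqr_ge0.
    by rewrite integral_sqr_angle ray_mass_half EFinM.
  apply: measurable_funX; apply: measurable_funB => //.
  by apply: continuous_measurable_fun => u; exact: continuous_atan.
by rewrite /= mul1r.
Qed.

Lemma continuous_sq_angle y : continuous (sq_angle^~ y).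
Proof.
move=> x; apply: cvgM; first exact: cvg_cst.
apply: (cvg_comp (fun x => pi / 2 - atan ((y 0 i0 + x) / rad y)) (fun x => x ^+ 2));
  last exact: exprn_continuous.
apply: cvgB; first exact: cvg_cst.
apply: (cvg_comp (fun x => (y 0 i0 + x) / rad y) (@atan R)); last exact: continuous_atan.
apply: cvgM; last exact: cvg_cst.
by apply: cvgD; [exact: cvg_cst|exact: cvg_id].
Qed.

(** The integrand is continuous in x and bounded by pi^2. *)
Lemma continuous_msq_angle : continuous msq_angle.
Proof.
move=> a; have aI : a \in (`]a - 1, a + 1[%classic : set R).
  by rewrite inE/= in_itv/= ltrBlDr ltrDl ltr01.
have icst : G3.-integrable setT (EFin \o (fun _ : T3 => pi ^+ 2 : R)).
  apply: (@bounded_integrable _ _ _ _ _ (pi ^+ 2)) => // p.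
  by rewrite ger0_norm// sqr_ge0.
apply: (@continuity_under_integral _ _ _ G3
  (fun x p => sq_angle x (vec p)) setT measurableT (a - 1) (a + 1) _ _ _ icst) aI => //.
- by apply: aeW => p _ x _; exact: continuous_sq_angle.
- by move=> x _; apply: aeW => p _; exact: sq_angle_le.
Qed.

Lemma sq_angle_cvg0 y : sq_angle n%:R y @[n --> \oo] --> (0 : R).
Proof.
rewrite /sq_angle; have [->|r0] := eqVneq (rad y) 0.
  rewrite !mul0r; under eq_fun do rewrite mul0r; exact: cvg_cst.
have r1 : 0 < rad y by rewrite lt0r r0 rad_ge0.
rewrite -[X in _ --> X](mulr0 (rad y / rad y)); apply: cvgM; first exact: cvg_cst.
rewrite [X in _ --> X](_ : 0 = (pi / 2 - pi / 2 : R) ^+ 2); last first.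
  by rewrite subrr expr0n.
apply: (cvg_comp (fun n : nat => pi / 2 - atan ((y 0 i0 + n%:R) / rad y))
  (fun x : R => x ^+ 2)); last exact: exprn_continuous.
apply: cvgB; first exact: cvg_cst.
apply: (cvg_comp (fun n : nat => (y 0 i0 + n%:R) / rad y) (@atan R)); last exact: cvgy_atan.
have r2 : 0 < (rad y)^-1 by rewrite invr_gt0.
have sh : ((y 0 i0 + x) / rad y) @[x --> +oo] --> +oo.
  by apply: gt0_cvgMly => //; exact: cvg_addrl.
exact: (cvg_comp _ _ cvgr_idn sh).
Qed.

Lemma msq_angle_cvg0 : msq_angle n%:R @[n --> \oo] --> (0 : R).
Proof.
have mang x : measurable_fun setT (fun p : T3 => (sq_angle x (vec p))%:E).
  by apply/measurable_EFinP; apply: measurable_sq_angle; exact: mvec_vec.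
have icst : G3.-integrable setT (EFin \o (fun _ : T3 => pi ^+ 2 : R)).
  apply: (@bounded_integrable _ _ _ _ _ (pi ^+ 2)) => // p.
  by rewrite ger0_norm// sqr_ge0.
have cang : {ae G3, forall p, setT p ->
    (sq_angle n%:R (vec p))%:E @[n --> \oo] --> (0 : \bar R)%E}.
  apply: aeW => p _; apply: cvg_EFin; last exact: sq_angle_cvg0.
  by apply: nearW => n.
have bang : {ae G3, forall p n, setT p ->
    (`|(sq_angle n%:R (vec p))%:E| <= (pi ^+ 2)%:E)%E}.
  by apply: aeW => p n _; exact: sq_angle_le.
have [_ _] := dominated_convergence measurableT (fun n => mang n%:R)
  (measurable_cst _) cang icst bang.
rewrite integral0 => /fine_cvg.
by apply.
Qed.

End angle_moment.

(** * The covariance and its trace *)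

Section covariance.
Variable R : realType.
Local Notation i0 := (inord 0 : 'I_3).
Local Notation i1 := (inord 1 : 'I_3).
Local Notation i2 := (inord 2 : 'I_3).
Implicit Types (mu m : 'rV[R]_3) (sigma : R).

Let i01 : (i0 == i1) = false. Proof. by rewrite -val_eqE/= !inordK. Qed.
Let i02 : (i0 == i2) = false. Proof. by rewrite -val_eqE/= !inordK. Qed.

Lemma rad_shifted (r sigma : R) x : 0 <= sigma ->
  rad (shifted r sigma x) = sigma * rad x.
Proof.
move=> s0; rewrite /rad /shifted !mxE !(eq_sym _ i0) i01 i02 !andbF !mulr0 !add0r.
by rewrite !exprMn -mulrDr sqrtrM ?sqr_ge0// sqrtr_sqr ger0_norm.
Qed.

(** The angle of a vector does not change when the vector is divided by sigma. *)
Lemma log_mom_msq_angle (r sigma : R) : 0 < sigma ->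
  log_mom r sigma i1 i1 = msq_angle (r / sigma) / 2.
Proof.
move=> s0; rewrite log_mom_half /msq_angle; congr (_ / 2); apply: eq_Rintegral => p _.
set x := vec p; rewrite dot_log_e1 rad_shifted ?ltW// mulf_eq0 gt_eqF//= /sq_angle.
case: ifPn => [/eqP->|r0]; first by rewrite !mul0r.
rewrite divff// mul1r /shifted !mxE !eqxx mulr1; congr ((_ - atan _) ^+ 2).
by field; rewrite r0 gt_eqF.
Qed.

Lemma log_mom_point (r : R) : log_mom r 0 i1 i1 = 0.
Proof.
rewrite log_mom_half /Rintegral integral0_eq ?mul0r// => p _.
by rewrite dot_log_e1 rad_shifted// mul0r eqxx.
Qed.

(** The kernel of a nonzero linear form on a space of dimension 3. *)
Lemma dim_tangent_space m : m != 0 -> \dim (tangent_space m) = 2%N.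
Proof.
move=> m0; rewrite /tangent_space; set f := linfun _.
have := limg_ker_dim f fullv; rewrite capfv dimvf /dim/=.
have -> : \dim (limg f) = 1%N.
  apply/eqP; rewrite eqn_leq; apply/andP; split.
    by rewrite (leq_trans (dimvS (subvf _)))// dimvf.
  rewrite lt0n dimv_eq0; apply/negP => /eqP f0.
  have : f m \in limg f by rewrite memv_img// memvf.
  rewrite f0 memv0 lfunE/= => /eqP/matrixP/(_ 0 0)/eqP.
  by rewrite [X in _ == X]mxE -/(dot m m) dot_eq0 (negbTE m0).
by rewrite addn1 => -[].
Qed.

Lemma lfun_trace_scale (V : vectType R) (c : R) :
  lfun_trace (c *: \1%VF : 'End(V)) = c * (\dim {:V})%:R.
Proof.
rewrite /lfun_trace; set b := vbasis _.
have fb : free b by exact: basis_free (vbasisP _).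
have m0 := passmx.mxof_linear b b (-1) 0 0.
have := passmx.mxof_linear b b c \1%VF 0.
rewrite scaler0 addr0 scaleN1r addNr in m0.
by rewrite addr0 m0 addr0 passmx.mxof1// => ->; rewrite mxtraceZ mxtrace1.
Qed.

(** On the tangent plane at m the matrix 1 - m^T m acts as the identity. *)
Lemma intrinsic_cov_isotropic d (T : measurableType d) (P : probability T R)
  (X : T -> 'rV[R]_3) mu sigma : mu != 0 -> isotropic_normal P X mu sigma ->
  intrinsic_cov P (@pr R \o X) = log_mom (enorm mu) sigma i1 i1 *: \1%VF.
Proof.
move=> mu0 isoX; have im := intrinsic_mean_isotropic mu0 isoX.
have lm := log_moment_isotropic mu0 isoX.
rewrite /intrinsic_cov; set c := log_mom _ _ _ _.
have momE u : u \in tangent_space (intrinsic_mean P (@pr R \o X)) ->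
    u *m log_moment P (@pr R \o X) (intrinsic_mean P (@pr R \o X)) = c *: u.
  rewrite im lm -/c tangent_spaceE => /eqP um.
  by rewrite -scalemxAr mulmxBr mulmx1 mulmxA mul_trmx_row um scale0r subr0.
have E (w : subvs_of (tangent_space (intrinsic_mean P (@pr R \o X)))) :
    vsproj (tangent_space (intrinsic_mean P (@pr R \o X)))
      (vsval w *m log_moment P (@pr R \o X) (intrinsic_mean P (@pr R \o X))) = c *: w.
  rewrite -[w in RHS]vsvalK -linearZ/=; congr (vsproj _ _).
  exact/momE/subvsP.
rewrite (_ : (fun w => _) = *:%R c); last by apply/funext => w; exact: E.
by apply/lfunP => w; rewrite lfunE/= scale_lfunE id_lfunE.
Qed.

Lemma trace_intrinsic_cov d (T : measurableType d) (P : probability T R)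
  (X : T -> 'rV[R]_3) mu sigma : mu != 0 -> isotropic_normal P X mu sigma ->
  lfun_trace (intrinsic_cov P (@pr R \o X)) / 2 = log_mom (enorm mu) sigma i1 i1.
Proof.
move=> mu0 isoX; have im := intrinsic_mean_isotropic mu0 isoX.
rewrite (intrinsic_cov_isotropic mu0 isoX) lfun_trace_scale.
have -> : \dim {:subvs_of (tangent_space (intrinsic_mean P (@pr R \o X)))} = 2%N.
  by rewrite dimvf -[RHS](dim_tangent_space (sphere_neq0 (pr_sphere mu0))) -im.
by rewrite mulfK.
Qed.

(** With l = (sigma / |mu|)^2 the argument of [msq_angle] is |mu| / sigma; the
    value at l = 0 is that of a point mass. *)
Definition half_trace (l : R) : R :=
  if l == 0 then 0 else msq_angle (Num.sqrt l)^-1 / 2.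

Lemma half_traceE mu sigma : mu != 0 -> 0 <= sigma ->
  half_trace (sigma ^+ 2 / enorm mu ^+ 2) = log_mom (enorm mu) sigma i1 i1.
Proof.
move=> mu0 s0; have e0 : 0 < enorm mu by rewrite enorm_gt0.
rewrite /half_trace mulf_eq0 invr_eq0 !sqrf_eq0 (gt_eqF e0) orbF.
have [->|sn0] := eqVneq sigma 0; first by rewrite log_mom_point.
rewrite log_mom_msq_angle ?lt0r ?sn0// -expr_div_n sqrtr_sqr ger0_norm ?divr_ge0 ?(ltW e0)//.
by rewrite invf_div.
Qed.

Let msq_angle_inj (x y : R) : msq_angle x = msq_angle y -> x = y.
Proof. by case: (ltgtP x y) => // /msq_angle_lt + E; rewrite E ltxx. Qed.

Let msq_angle_max : msq_angle (0 : R) / 2 = (pi ^+ 2 - 4) / 4.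
Proof. by rewrite msq_angle0; field. Qed.

Lemma half_trace_bounds l : 0 <= l -> 0 <= half_trace l < (pi ^+ 2 - 4) / 4.
Proof.
move=> l0; rewrite /half_trace -msq_angle_max.
case: ifPn => [_|ln0].
  by rewrite lexx divr_gt0// (le_lt_trans (msq_angle_ge0 1) (msq_angle_lt ltr01)).
rewrite divr_ge0 ?msq_angle_ge0//= ltr_pM2r ?invr_gt0//.
by apply: msq_angle_lt; rewrite invr_gt0 sqrtr_gt0 lt0r ln0.
Qed.

(** [msq_angle] decreases strictly and continuously from its value at 0 to 0 at
    infinity, so the intermediate value theorem gives surjectivity. *)
Lemma half_trace_bij :
  set_bij `[0, +oo[ `[0, (pi ^+ 2 - 4) / 4[ half_trace.
Proof.
have msq_angle_gt0 (x : R) : 0 < msq_angle x.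
  by rewrite (le_lt_trans (msq_angle_ge0 (x + 1)))// msq_angle_lt ?ltrDl.
split.
- move=> l /=; rewrite !in_itv/= andbT; exact: half_trace_bounds.
- move=> l l'; rewrite !inE/= !in_itv/= !andbT => l0 l'0; rewrite /half_trace.
  case: ifPn => [/eqP->|ln0]; case: ifPn => [/eqP->|l'n0]//.
  + by move=> /esym/eqP; rewrite gt_eqF// divr_gt0.
  + by move=> /eqP; rewrite gt_eqF// divr_gt0.
  + have h2 : (2 : R)^-1 != 0 by rewrite invr_eq0 pnatr_eq0.
    move/(mulIf h2)/msq_angle_inj/invr_inj => sE.
    by rewrite -[LHS](sqr_sqrtr l0) -[RHS](sqr_sqrtr l'0) sE.
- move=> v /=; rewrite in_itv/= => /andP[v0 vlt].
  have [->|vn0] := eqVneq v 0.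
    by exists 0; [rewrite /= in_itv/= lexx|rewrite /half_trace eqxx].
  have vgt0 : 0 < v by rewrite lt0r vn0.
  have [N KN] : exists N : nat, msq_angle (N%:R : R) < v * 2.
    have /(@cvgr_lt _ _ _ _) := @msq_angle_cvg0 R.
    have v20 : 0 < v * 2 by rewrite mulr_gt0.
    by move=> /(_ _ v20) [N _ HN]; exists N; exact: HN (leqnn N).
  have Kv : v * 2 < msq_angle 0 by rewrite -ltr_pdivlMr// msq_angle_max.
  have [|x] := IVT (ler0n R N) (continuous_subspaceT (@continuous_msq_angle R))
    (v := v * 2).
    by rewrite ge_min le_max (ltW KN) (ltW Kv) orbT.
  rewrite in_itv/= => /andP[x_ge0 _] xv.
  have x0 : 0 < x.
    by rewrite lt0r x_ge0 andbT; apply/eqP => xE; rewrite -xv xE ltxx in Kv.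
  exists (x^-1 ^+ 2); first by rewrite /= in_itv/= andbT sqr_ge0.
  rewrite /half_trace sqrf_eq0 invr_eq0 gt_eqF// sqrtr_sqr ger0_norm ?invr_ge0 ?ltW//.
  by rewrite invrK xv mulfK.
Qed.

End covariance.

Theorem proposition2p7 (R : realType) :
  exists f : R -> R,
    (forall (d : measure_display) (T : measurableType d) (P : probability T R)
        (X : T -> 'rV[R]_3) (mu : 'rV[R]_3) (sigma : R),
      mu != 0 -> 0 <= sigma -> isotropic_normal P X mu sigma ->
      exists v : R,
        [/\ 0 <= v < (pi ^+ 2 - 4) / 4,
            intrinsic_cov P (@pr R \o X) = v *: \1%VF,
            f (sigma ^+ 2 / enorm mu ^+ 2)
              = lfun_trace (intrinsic_cov P (@pr R \o X)) / 2
          & f (sigma ^+ 2 / enorm mu ^+ 2) = v])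
    /\ set_bij `[0, +oo[ `[0, (pi ^+ 2 - 4) / 4[ f.
Proof.
exists (@half_trace R); split; last exact: half_trace_bij.
move=> d T P X mu sigma mu0 s0 isoX.
exists (half_trace (sigma ^+ 2 / enorm mu ^+ 2)); split=> //.
- by apply: half_trace_bounds; rewrite divr_ge0 ?sqr_ge0.
- by rewrite half_traceE//; exact: intrinsic_cov_isotropic.
- by rewrite half_traceE// (trace_intrinsic_cov mu0 isoX).
Qed.
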